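(* Let $d\ge1$, let $n_1,\dots,n_d\ge1$ be integers with $n=n_1\cdots n_d>1$, let $\mathbf x_1,\dots,\mathbf x_n$ be an enumeration of the lattice design $\mathbb L_{n_1,\dots,n_d}$, and let $\sigma>0$. Fix $f^*:[0,1]^d\to\mathbb R$, let $y_i=f^*(\mathbf x_i)+\xi_i$ with $\xi_1,\dots,\xi_n$ i.i.d. $N(0,\sigma^2)$, and consider the estimator $$\hat f_{\mathrm{HK}\mathbf 0,V}\in\operatorname*{arg\,min}_{f:\,V_{\mathrm{HK}\mathbf 0}(f)\le V}\frac1n\sum_{i=1}^n (y_i-f(\mathbf x_i))^2$$ with tuning parameter $V>0$. Then for every $0<c\le 1/2$, $$\mathcal R(\hat f_{\mathrm{HK}\mathbf 0,V},f^* )\le\inf_{\substack{f\in\mathfrak R^d_1(c):\\ V_{\mathrm{HK}\mathbf 0}(f)=V}}\left\{\mathcal L(f,f^* )+C(c,d)\frac{\sigma^2}{n}(\log(en))^{\frac{3d}{2}}(\log(e\log(en)))^{\frac{2d-1}{2}}\right\}$$ for a constant $C(c,d)$ that depends only on $c$ and $d$.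
   Context: Notation: $\mathbf 0=(0,\dots,0)$, $\mathbf 1=(1,\dots,1)$; $\mathbf a\preceq\mathbf b$ means $a_j\le b_j$ for all $j$; for $\mathbf a\preceq\mathbf b$, $[\mathbf a,\mathbf b]=\prod_j[a_j,b_j]$ and $[\mathbf a,\mathbf b)=\prod_j[a_j,b_j)$. $\mathbb I_A$ is the indicator function of $A$. Quasi-volume: for $f:[0,1]^d\to\mathbb R$ and distinct $\mathbf a\preceq\mathbf b$ in $[0,1]^d$, $$\Delta(f;[\mathbf a,\mathbf b])=\sum_{j_1=0}^{J_1}\cdots\sum_{j_d=0}^{J_d}(-1)^{j_1+\dots+j_d}f(b_1+j_1(a_1-b_1),\dots,b_d+j_d(a_d-b_d)),$$ where $J_i=1$ if $a_i\ne b_i$ and $J_i=0$ otherwise. Vitali variation: given univariate partitions $0=x^{(s)}_0<\dots<x^{(s)}_{k_s}=1$, $s=1,\dots,d$, the split they generate is the collection $\mathcal P$ of all rectangles $\prod_{s=1}^d[x^{(s)}_{l_s},x^{(s)}_{l_s+1}]$, $0\le l_s\le k_s-1$. Set $V^{(d)}(f;[0,1]^d)=\sup_{\mathcal P}\sum_{A\in\mathcal P}|\Delta(f;A)|$, supremum over all such splits. HK$\mathbf 0$ variation: for nonempty $S\subseteq\{1,\dots,d\}$ let $f_S:[0,1]^{|S|}\to\mathbb R$ be the restriction of $f$ to $\{\mathbf u\in[0,1]^d:u_j=0\ \forall j\notin S\}$, viewed as a function of the coordinates in $S$. Then $V_{\mathrm{HK}\mathbf 0}(f)=\sum_{\varnothing\ne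 S\subseteq\{1,\dots,d\}}V^{(|S|)}(f_S;[0,1]^{|S|})$. Lattice design: $\mathbb L_{n_1,\dots,n_d}=\{(i_1/n_1,\dots,i_d/n_d):0\le i_j\le n_j-1,\ j=1,\dots,d\}$. The class $\mathfrak R_1^d(c)$: all $f:[0,1]^d\to\mathbb R$ of the form $f=a_1\mathbb I_{[\mathbf x^*,\mathbf 1]}+a_0$ with $a_1,a_0\in\mathbb R$ and $\mathbf x^*\in[0,1]^d$ satisfying $\min\{|\mathbb L_{n_1,\dots,n_d}\cap[\mathbf x^*,\mathbf 1]|,\ |\mathbb L_{n_1,\dots,n_d}\cap[\mathbf 0,\mathbf x^* )|\}\ge cn$. Loss and risk: $\mathcal L(g,f^* )=\frac1n\sum_{i=1}^n(g(\mathbf x_i)-f^*(\mathbf x_i))^2$ and $\mathcal R(\hat f,f^* )=\mathbb E\,\mathcal L(\hat f,f^* )$. The values of the estimator at the design points do not depend on the choice of minimizer. An infimum over the empty set is $+\infty$. *)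

(* Defs.v *)
(* Built on MathComp-Analysis. *)
From HB Require Import structures.
From mathcomp Require Import all_boot all_order all_algebra finmap.
From mathcomp Require Import all_classical all_reals all_analysis.

Set Implicit Arguments.
Unset Strict Implicit.
Unset Printing Implicit Defensive.

Import Order.TTheory GRing.Theory Num.Theory.
Import numFieldNormedType.Exports.

Local Open Scope classical_set_scope.
Local Open Scope ring_scope.

(* Points have coordinates indexed by an arbitrary finite type [I], so that the
   face of the cube attached to a set S of coordinates is literally the cube
   indexed by S.  Real functions on the cube are represented by total functions
   on [{ffun I -> R}]; every definition below evaluates them only at points of
   the cube. *)

Section Boxes.
Context {R : realType} {I : finType}.
Implicit Types a b : {ffun I -> R}.

Definition zeros : {ffun I -> R} := [ffun=> 0].
Definition ones : {ffun I -> R} := [ffun=> 1].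

Definition closed_box a b : set {ffun I -> R} :=
  [set u | forall j, a j <= u j <= b j].

Definition halfopen_box a b : set {ffun I -> R} :=
  [set u | forall j, a j <= u j < b j].

Definition unit_cube : set {ffun I -> R} := closed_box zeros ones.

End Boxes.

Section Variation.
Context {R : realType}.

(* The index [e] is the tuple (j_1, ..., j_d) of the alternating sum, with
   [e i] allowed to be 1 only when [a i != b i]. *)
Definition quasi_volume (I : finType) (f : {ffun I -> R} -> R)
    (a b : {ffun I -> R}) : R :=
  \sum_(e : {ffun I -> bool} | [forall i, e i ==> (a i != b i)])
    (-1) ^+ (\sum_i e i)%N * f [ffun i => b i + (e i)%:R * (a i - b i)].

(* As in [itv_partition], the list [s i] omits the initial point 0: the points
   of the i-th partition are those of [0 :: s i], so there are [size (s i)]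
   consecutive intervals. *)
Definition partition_node (I : finType) (s : I -> seq R) (l : I -> nat) :
    {ffun I -> R} := [ffun i => nth 1 (0 :: s i) (l i)].

Definition split_sum (I : finType) (f : {ffun I -> R} -> R)
    (s : I -> seq R) : R :=
  \sum_(l : {dffun forall i : I, 'I_(size (s i))})
    `|quasi_volume f (partition_node s (fun i => l i))
                     (partition_node s (fun i => (l i).+1))|.

Definition vitali_variation (I : finType) (f : {ffun I -> R} -> R) : \bar R :=
  ereal_sup [set (split_sum f s)%:E |
             s in [set s : I -> seq R | forall i, itv_partition 0 1 (s i)]].

Definition face_restriction (I : finType) (S : {set I})
    (f : {ffun I -> R} -> R) : {ffun {i : I | i \in S} -> R} -> R :=
  fun u => f [ffun j => oapp (fun k => u k) 0 (insub j)].

Definition hk0_variation (I : finType) (f : {ffun I -> R} -> R) : \bar R :=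
  (\sum_(S : {set I} | S != finset.set0)
     vitali_variation (face_restriction (S := S) f))%E.

End Variation.

Section Design.
Context {R : realType} {d : nat}.
Local Notation point := {ffun 'I_d -> R}.

Definition lattice_design (ns : 'I_d -> nat) : set point :=
  [set u | exists i : 'I_d -> nat,
     forall j, (i j < ns j)%N /\ u j = (i j)%:R / (ns j)%:R].

(* [fset_set] turns a finite set into an [{fset _}]; the sets counted here are
   finite since [lattice_design ns] is. *)
Definition rect_indicators (ns : 'I_d -> nat) (c : R) : set (point -> R) :=
  [set f | exists (a1 a0 : R) (xstar : point),
     [/\ unit_cube xstar,
         forall u, unit_cube u -> f u = a1 * \1_(closed_box xstar ones) u + a0
       & c * (\prod_(j < d) ns j)%N%:R <=
           (minn #|` fset_set (lattice_design ns `&` closed_box xstar ones)|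
                 #|` fset_set (lattice_design ns `&` halfopen_box zeros xstar)|)
           %:R]].

Definition sq_loss (n : nat) (x : 'I_n -> point) (g h : point -> R) : R :=
  n%:R^-1 * \sum_(i < n) (g (x i) - h (x i)) ^+ 2.

Definition hk0_least_squares (n : nat) (x : 'I_n -> point) (y : 'I_n -> R)
    (V : R) : set (point -> R) :=
  let obj f := n%:R^-1 * \sum_(i < n) (y i - f (x i)) ^+ 2 in
  [set f | (hk0_variation f <= V%:E)%E /\
     forall g, (hk0_variation g <= V%:E)%E -> obj f <= obj g].

End Design.

Section Noise.
Context {R : realType} {dT : measure_display} {T : measurableType dT}.

Definition mutually_independent (P : probability T R) (K : finType)
    (X : K -> {RV P >-> R}) : Prop :=
  forall (J : {set K}) (A : K -> set R), (forall k, measurable (A k)) ->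
    P (\bigcap_(k in [set` J]) (X k @^-1` A k)) =
    (\prod_(k in J) P (X k @^-1` A k))%E.

(* [normal_prob] takes the standard deviation, not the variance. *)
Definition iid_normal (P : probability T R) (K : finType)
    (X : K -> {RV P >-> R}) (sigma : R) : Prop :=
  mutually_independent X /\
  forall k (A : set R), measurable A ->
    distribution P (X k) A = normal_prob 0 sigma A.

Definition risk (P : probability T R) (d n : nat)
    (x : 'I_n -> {ffun 'I_d -> R}) (fhat : T -> {ffun 'I_d -> R} -> R)
    (fstar : {ffun 'I_d -> R} -> R) : \bar R :=
  ('E_P[fun w => sq_loss x (fhat w) fstar])%E.

End Noise.

(* Main.v *)
Require Import Defs.
From mathcomp Require Import all_boot all_order all_algebra.
From mathcomp Require Import finmap.
From mathcomp Require Import all_classical all_reals all_analysis.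
From mathcomp Require Import measurable_realfun zify ring lra.

(* On the grid, a function is a combination of the indicators [orthant z] of upper
   orthants, its coefficients are its mixed differences, and the HK0 variation
   dominates their l1 norm off the constant coefficient.  At the competitor
   [a1 * orthant zs + a0] the constraint is active, so the difference h between
   estimator and competitor has coefficients b with
   [sg * b zs + sum_(z <> 0, zs) |b z| <= 0], where sg is the sign of a1.
   It remains to bound [2 <xi, h> - |h|^2 / 2] over this cone.

   The noise is split by projecting on functions constant on product blocks whose
   sides grow geometrically, by the factor [1 + 1 / sqrt L], L = log (e n), away
   from zs.  There are O(L^(3d/2)) blocks, which is the cost of the projected part.
   What is left of [orthant z] has squared norm at most a multiple of
   [n / sqrt L * (1 - q z)^2] for the dual certificate
   [q z = prod_j (1 - sqrt |z_j - zs_j|)] (distances rescaled to reach 1 at the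
   boundary).  A union bound over the n Gaussian forms, the cone condition and the
   identity [q z = <psi, orthant z>], [|psi|^2 = O(L^d / n)], bound the remaining
   part by O(L^(d + 1/2)), and [d + 1/2 <= 3 d / 2]. *)

Set Implicit Arguments.
Unset Strict Implicit.
Unset Printing Implicit Defensive.

Import Order.TTheory GRing.Theory Num.Theory.
Import numFieldNormedType.Exports.

Local Open Scope classical_set_scope.
Local Open Scope ring_scope.

(** * Gaussian linear forms *)

(** The integral of a nonnegative function is a supremum over the simple functions below it, so
    monotonicity holds without measurability. The loss of the estimator needs this, [fhat] being an
    arbitrary selection of minimizers. *)
Lemma ge0_le_integral_nonmeas (dT : measure_display) (T : measurableType dT)
    (R : realType) (mu : {measure set T -> \bar R}) (f g : T -> \bar R) :
  (forall w, 0 <= f w)%E -> (forall w, f w <= g w)%E ->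
  (\int[mu]_w f w <= \int[mu]_w g w)%E.
Proof.
move=> f0 fg; have g0 w : (0 <= g w)%E := le_trans (f0 w) (fg w).
rewrite !ge0_integralTE//; apply: ge_ereal_sup => _ [h /= hf <-].
by apply: ereal_sup_ubound; exists h => //= w; exact: le_trans (hf w) (fg w).
Qed.

(** * Image measures with a density *)

Section WeightedTransfer.
Context d1 d2 (T : measurableType d1) (Y : measurableType d2) (R : realType).
Variables (mu : {measure set T -> \bar R}) (nu : {measure set Y -> \bar R}).
Variables (phi : T -> Y) (W : T -> R) (c : R).
Hypotheses (mphi : measurable_fun setT phi) (mW : measurable_fun setT W).
Hypothesis W0 : forall w, 0 <= W w.
Hypothesis munu : forall B, measurable B ->
  (\int[mu]_w (\1_B (phi w) * W w)%:E = c%:E * nu B)%E.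

Import HBNNSimple.

Let transfer_nnsfun (h : {nnsfun Y >-> R}) :
  (\int[mu]_w (h (phi w) * W w)%:E = c%:E * \int[nu]_y (h y)%:E)%E.
Proof.
have mh r : measurable (h @^-1` [set r]) by [].
have mph r : measurable_fun setT (\1_(h @^-1` [set r]) \o phi : T -> R).
  by apply: measurableT_comp => //; exact: measurable_indic.
transitivity (\sum_(r \in range h)
    \int[mu]_w (r * (\1_(h @^-1` [set r]) (phi w) * W w))%:E)%E.
  rewrite -ge0_integral_fsum//; last 2 first.
  - move=> r; apply/measurable_EFinP; apply: measurable_funM => //.
    by apply: measurable_funM => //; exact: mph.
  - move=> r w _; rewrite lee_fin mulrA mulr_ge0//.
    by have := nnfun_muleindic_ge0 h r (phi w); rewrite -EFinM lee_fin.
  apply: eq_integral => w _; rewrite fsumEFin//; congr EFin.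
  rewrite [in LHS]fimfunE !fsbig_finite//= big_distrl/=.
  by apply: eq_bigr => r _; rewrite mulrA.
transitivity (\sum_(r \in range h) c%:E *
    \int[nu]_y (r * \1_(h @^-1` [set r]) y)%:E)%E.
  apply: eq_fsbigr => r; rewrite inE => -[y _ hr].
  have r0 : 0 <= r by rewrite -hr.
  rewrite integralZl_indic_nnsfun// integral_indic// setIT.
  under eq_integral do rewrite EFinM.
  rewrite ge0_integralZl_EFin//.
  - by rewrite munu// muleCA.
  - by move=> w _; rewrite lee_fin mulr_ge0.
  - by apply/measurable_EFinP; apply: measurable_funM => //; exact: mph.
rewrite -ge0_mule_fsumr; last first.
  move=> r; apply: integral_ge0 => y _.
  by have := nnfun_muleindic_ge0 h r y; rewrite -EFinM.
rewrite -ge0_integral_fsum//; last 2 first.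
- by move=> r; apply/measurable_EFinP; exact: measurable_funM.
- by move=> r y _; have := nnfun_muleindic_ge0 h r y; rewrite -EFinM.
congr (_ * _)%E; apply: eq_integral => y _.
by rewrite fsumEFin// [in RHS]fimfunE.
Qed.

(** [munu] says that [c * nu] is the image under [phi] of the measure with density [W]; simple
    functions and monotone convergence extend this from sets to functions. It serves to split one
    factor off an independent product and to integrate against a normal law through its density. *)
Lemma ge0_integral_transfer (f : Y -> R) :
  measurable_fun setT f -> (forall y, 0 <= f y) ->
  (\int[mu]_w (f (phi w) * W w)%:E = c%:E * \int[nu]_y (f y)%:E)%E.
Proof.
move=> mf f0; have mEf : measurable_fun setT (EFin \o f) by exact/measurable_EFinP.
pose f_ := nnsfun_approx measurableT mEf.
have cvf y : EFin \o f_^~ y @ \oo --> (f y)%:E.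
  by apply: (@cvg_nnsfun_approx _ _ _ _ measurableT _ mEf) => // *; rewrite lee_fin.
have ndf y m n : (m <= n)%N -> (f_ m y <= f_ n y)%R.
  by move=> mn; exact/lefP/nd_nnsfun_approx.
transitivity (limn (fun n => \int[mu]_w (f_ n (phi w) * W w)%:E)%E).
  rewrite -monotone_convergence//.
  - apply: eq_integral => w _; apply/esym/cvg_lim => //.
    under [X in X @ _]eq_fun do rewrite EFinM.
    rewrite EFinM; apply: cvgeMr => //; exact: cvf.
  - move=> n; apply/measurable_EFinP; apply: measurable_funM => //.
    by apply: measurableT_comp.
  - by move=> n w _; rewrite lee_fin mulr_ge0.
  - by move=> w _ m n mn; rewrite lee_fin ler_wpM2r// ndf.
under eq_fun do rewrite transfer_nnsfun.
rewrite [in RHS](_ : \int[nu]_y (f y)%:E =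
    limn (fun n => \int[nu]_y (f_ n y)%:E))%E; last first.
  rewrite -monotone_convergence//=.
  - by apply: eq_integral => y _; apply/esym/cvg_lim => //; exact: cvf.
  - by move=> n; apply/measurable_EFinP.
  - by move=> n w _; rewrite lee_fin.
  - by move=> w _ m n mn; rewrite lee_fin ndf.
rewrite -limeMl//.
apply/ereal_nondecreasing_is_cvgn => a b ab; apply: ge0_le_integral => //.
- by move=> y _; rewrite lee_fin.
- exact/measurable_EFinP.
- exact/measurable_EFinP.
- by move=> y _; rewrite lee_fin ndf.
Qed.

End WeightedTransfer.

(** * Products of independent variables *)

Section Independence.
Context {R : realType} {dT : measure_display} {T : measurableType dT}.
Context {P : probability T R} {K : finType}.
Implicit Type X : K -> {RV P >-> R}.

Lemma measurable_prod_comp X (f : K -> R -> R) (Q : pred K) :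
  (forall k, measurable_fun setT (f k)) ->
  measurable_fun setT (fun w => \prod_(k | Q k) f k (X k w)).
Proof.
move=> mf; under eq_fun do rewrite big_mkcond; apply: measurable_prod => k _.
by case: (Q k) => //; apply: measurableT_comp => //; exact: mf.
Qed.

(* The factors outside [J] are indicators; they are replaced one at a time by
   arbitrary nonnegative functions. *)
Lemma integral_prod_indep_seq X (indX : mutually_independent X) (J : seq K)
    (f : K -> R -> R) :
  (forall k, measurable_fun setT (f k)) -> (forall k y, 0 <= f k y) ->
  (forall k, \int[distribution P (X k)]_y (f k y)%:E < +oo)%E ->
  (forall k, k \notin J -> exists2 A, measurable A & f k = \1_A) ->
  (\int[P]_w (\prod_k f k (X k w))%:E =
   \prod_k \int[distribution P (X k)]_y (f k y)%:E)%E.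
Proof.
elim: J f => [|k0 J IH] f mf f0 foo fJ.
  have {}/choice[A fA] k : exists A, measurable A /\ f k = \1_A.
    by have [A mA ->] := fJ k isT; exists A.
  have mA k := (fA k).1.
  transitivity (P (\bigcap_(k in [set` [set: K]%SET]) (X k @^-1` A k))).
    rewrite -[X in P X]setIT -integral_indic//; last first.
      apply: fin_bigcap_measurable => // k _.
      by rewrite -[X in measurable X]setTI; exact: measurable_funPT.
    apply: eq_integral => w _; congr EFin.
    under eq_bigr do rewrite (fA _).2.
    rewrite indicE; case: (boolP (w \in _)) => wA.
      rewrite big1// => k _; rewrite indicE mem_set//.
      by move/set_mem: wA; apply; rewrite /= finset.in_setT.
    move: wA; rewrite notin_setE => wA.
    have /existsNP[k wk] : ~ forall k, A k (X k w).
      by move=> h; apply: wA => k _; exact: h.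
    by rewrite (bigD1 k)//= indicE memNset ?mul0r.
  rewrite indX// (eq_bigl xpredT); last by move=> k; rewrite finset.in_setT.
  by apply: eq_bigr => k _; rewrite (fA k).2 integral_indic// setIT.
pose fB B k := if k == k0 then \1_B else f k.
have fB0 B k y : 0 <= fB B k y :> R by rewrite /fB; case: ifP.
pose W w := \prod_(k | k != k0) f k (X k w).
pose c := (\prod_(k | k != k0) \int[distribution P (X k)]_y (f k y)%:E)%E.
have I0 k : (0 <= \int[distribution P (X k)]_y (f k y)%:E)%E.
  by apply: integral_ge0 => y _; rewrite lee_fin.
have cfin : c \is a fin_num.
  by apply: prode_fin_num => k _; rewrite ge0_fin_numE.
have W0 w : 0 <= W w by apply: prodr_ge0.
have mW : measurable_fun setT W by exact: measurable_prod_comp.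
(* With the factor at [k0] replaced by an indicator the induction hypothesis applies. It says that
   the image under [X k0] of the measure with density [W] is a multiple of the law of [X k0]. *)
have key B : measurable B ->
    (\int[P]_w (\1_B (X k0 w) * W w)%:E =
     (fine c)%:E * distribution P (X k0) B)%E.
  move=> mB; transitivity (\int[P]_w (\prod_k fB B k (X k w))%:E)%E.
    apply: eq_integral => w _; rewrite (bigD1 k0)//= {1}/fB eqxx.
    by congr (_ * _)%:E; apply: eq_bigr => k /negbTE kk0; rewrite /fB kk0.
  rewrite IH//.
  - rewrite fineK// (bigD1 k0)//= muleC {2}/fB eqxx integral_indic// setIT.
    by congr (_ * _)%E; apply: eq_bigr => k /negbTE kk0; rewrite /fB kk0.
  - by move=> k; rewrite /fB; case: ifP => // _; exact: measurable_indic.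
  - move=> k; rewrite /fB; case: ifP => // _.
    by rewrite integral_indic// setIT (le_lt_trans (probability_le1 _ _)) ?ltry.
  - move=> k kJ; rewrite /fB; case: ifPn => [_|kk0]; first by exists B.
    by apply: fJ; rewrite inE negb_or kk0.
transitivity (\int[P]_w (f k0 (X k0 w) * W w)%:E)%E.
  by apply: eq_integral => w _; rewrite (bigD1 k0).
have mX : measurable_fun setT (X k0) by [].
rewrite (ge0_integral_transfer mX mW W0 key (mf k0) (f0 k0)).
by rewrite fineK// [RHS](bigD1 k0)//= muleC.
Qed.

Lemma integral_prod_indep X (indX : mutually_independent X) (f : K -> R -> R) :
  (forall k, measurable_fun setT (f k)) -> (forall k y, 0 <= f k y) ->
  (forall k, \int[distribution P (X k)]_y (f k y)%:E < +oo)%E ->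
  (\int[P]_w (\prod_k f k (X k w))%:E =
   \prod_k \int[distribution P (X k)]_y (f k y)%:E)%E.
Proof.
move=> mf f0 foo; apply: (integral_prod_indep_seq indX (J := enum K)) => // k.
by rewrite mem_enum.
Qed.

End Independence.

(** Completing the square: [expR (t * y)] times the centred density is [expR (s ^ 2 * t ^ 2 / 2)]
    times the density with mean [s ^ 2 * t]. *)
Lemma normal_mgf (R : realType) (s t : R) (nu : {measure set R -> \bar R}) :
  s != 0 -> (forall A, measurable A -> nu A = normal_prob 0 s A) ->
  (\int[nu]_y (expR (t * y))%:E = (expR (s ^+ 2 * t ^+ 2 / 2))%:E)%E.
Proof.
move=> s0 nuE.
have mexp : measurable_fun setT (fun y : R => expR (t * y)).
  by apply: measurableT_comp => //; exact: measurable_funM.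
have key (B : set R) : measurable B -> (\int[lebesgue_measure]_y
    (\1_B (id y) * normal_pdf 0 s y)%:E = 1%:E * nu B)%E.
  move=> mB; rewrite mul1e nuE// /normal_prob [RHS]integral_mkcond.
  apply: eq_integral => y _; rewrite patchE indicE.
  by case: (y \in B); rewrite ?mul1r ?mul0r.
have := @ge0_integral_transfer _ _ (measurableTypeR R) R R lebesgue_measure nu
  id (normal_pdf 0 s) 1 (@measurable_id _ _ _)
  (measurable_normal_pdf 0 s) (normal_pdf_ge0 0 s) key _ mexp
  (fun y => expR_ge0 _).
rewrite mul1e => <-.
transitivity (\int[lebesgue_measure]_y
    ((expR (s ^+ 2 * t ^+ 2 / 2))%:E * (normal_pdf (s ^+ 2 * t) s y)%:E))%E.
  apply: eq_integral => y _; rewrite -EFinM; congr EFin.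
  rewrite !normal_pdfE// /normal_fun mulrCA [RHS]mulrCA; congr (_ * _).
  by rewrite -!expRD; congr expR; field.
rewrite ge0_integralZl_EFin//.
- by rewrite integral_normal_pdf mule1.
- by move=> y _; rewrite lee_fin normal_pdf_ge0.
- by apply/measurable_EFinP; exact: measurable_normal_pdf.
Qed.

Section GaussianForms.
Context {R : realType} {dT : measure_display} {T : measurableType dT}.
Context {P : probability T R} {K : finType} {X : K -> {RV P >-> R}} {s : R}.
Hypotheses (s0 : 0 < s) (iidX : iid_normal X s).

Lemma iid_normal_mgf (r : K -> R) :
  (\int[P]_w (expR (\sum_k r k * X k w))%:E =
   (expR (s ^+ 2 * (\sum_k r k ^+ 2) / 2))%:E)%E.
Proof.
have I k : (\int[distribution P (X k)]_y (expR (r k * y))%:E =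
            (expR (s ^+ 2 * r k ^+ 2 / 2))%:E)%E.
  have sN0 : s != 0 by rewrite gt_eqF.
  exact: (normal_mgf (nu := distribution P (X k)) (r k) sN0 (iidX.2 k)).
under eq_integral do rewrite expR_sum.
rewrite (integral_prod_indep iidX.1 (f := fun k y => expR (r k * y))).
- under eq_bigr do rewrite I.
  by rewrite prodEFin -expR_sum mulr_sumr mulr_suml.
- by move=> k; apply: measurableT_comp => //; exact: measurable_funM.
- by move=> k y; exact: expR_ge0.
- by move=> k; rewrite I ltry.
Qed.

End GaussianForms.

(** Squaring [y / 2 <= expR (y / 2)]. *)
Lemma sqr_le_expR (R : realType) (y : R) : 0 <= y -> y ^+ 2 <= 4 * expR y.
Proof.
move=> y0; have -> : expR y = expR (y / 2) ^+ 2.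
  by rewrite -expRM_natl; congr expR; field.
have := expR_ge1Dx (y / 2); nra.
Qed.

Section GaussianMaximum.
Context {R : realType} {dT : measure_display} {T : measurableType dT}.
Context {P : probability T R} {K : finType} {X : K -> {RV P >-> R}} {s : R}.
Hypotheses (s0 : 0 < s) (iidX : iid_normal X s).

(* With l ^ 2 = L: [x ^ 2 <= 9 L / 2 + 2 (x - 3 l / 2)_+ ^ 2], and the positive
   part is dominated by an exponential whose mean is of order #|J| e ^ (- L). *)
Lemma gaussian_forms_max (J : finType) (r : J -> K -> R) (L : R) :
  (forall j, \sum_k r j k ^+ 2 <= 1) -> 1 <= L -> #|J|%:R <= expR L ->
  exists Y : T -> R, [/\ measurable_fun setT Y, forall w, 0 <= Y w,
    forall w j, (\sum_k r j k * X k w) ^+ 2 <= Y w &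
    (\int[P]_w (Y w)%:E <= (21 * s ^+ 2 * L)%:E)%E].
Proof.
move=> r1 L1 JL; pose l := Num.sqrt L.
have L0 : 0 < L by rewrite (lt_le_trans _ L1).
have l2 : l ^+ 2 = L by rewrite sqr_sqrtr// ltW.
have l0 : 0 < l by rewrite sqrtr_gt0.
(* Both signs are included so that the sum [S] dominates the exponential of [l * |z / s|] for each
   form [z]. *)
pose Z (b : bool) j w := \sum_k ((-1) ^+ b * l / s * r j k) * X k w.
have ZE b j w : Z b j w = (-1) ^+ b * l / s * \sum_k r j k * X k w.
  by rewrite /Z mulr_sumr; apply: eq_bigr => k _; rewrite mulrA.
pose S w := \sum_(p : bool * J) expR (Z p.1 p.2 w).
(* In units of [s], let [x] be the size of a form and [y = l * x - 3 / 2 * L]. When [y > 0], [(x - 3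
   / 2 * l) ^ 2 = y ^ 2 / L <= 4 * expR y / L] and [expR y <= expR (- (3 / 2 * L)) * S]; doubling
   gives [B]. *)
pose A := 9 / 2 * L * s ^+ 2.
pose B := 8 / L * expR (- (3 / 2 * L)) * s ^+ 2.
have B0 : 0 <= B.
  by rewrite !mulr_ge0 ?expR_ge0 ?invr_ge0 ?sqr_ge0// ltW.
have A0 : 0 <= A by rewrite !mulr_ge0 ?sqr_ge0// ltW.
have S0 w : 0 <= S w by apply: sumr_ge0 => p _; exact: expR_ge0.
have mZ b j : measurable_fun setT (fun w => expR (Z b j w)).
  apply: measurableT_comp => //; apply: measurable_sum => k.
  exact: measurable_funM.
have mS : measurable_fun setT S by apply: measurable_sum => p; exact: mZ.
exists (fun w => A + B * S w); split.
- by apply: measurable_funD => //; exact: measurable_funM.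
- by move=> w; rewrite addr_ge0// mulr_ge0.
- move=> w j; set z := \sum_k _.
  have zS : expR (l * `|z / s|) <= S w.
    have [b ->] : exists b : bool, l * `|z / s| = Z b j w.
      have [z0|z0] := lerP 0 z.
        exists false; rewrite ZE -/z ger0_norm ?divr_ge0 ?(ltW s0)//.
        by rewrite /=; ring.
      exists true; rewrite ZE -/z ler0_norm; first by rewrite /=; ring.
      by rewrite pmulr_lle0 ?invr_gt0// ltW.
    rewrite /S (bigD1 (b, j))//= lerDl; apply: sumr_ge0 => p _; exact: expR_ge0.
  pose x := `|z / s|.
  have zx : z ^+ 2 = x ^+ 2 * s ^+ 2.
    by rewrite /x real_normK ?num_real// -exprMn divfK ?gt_eqF.
  rewrite zx /A /B.
  have -> : 9 / 2 * L * s ^+ 2 + 8 / L * expR (- (3 / 2 * L)) * s ^+ 2 * S w =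
            (9 / 2 * L + 8 / L * (expR (- (3 / 2 * L)) * S w)) * s ^+ 2 by ring.
  rewrite ler_wpM2r ?sqr_ge0//.
  have x0 : 0 <= x by rewrite normr_ge0.
  have SE : expR (l * x - 3 / 2 * L) <= expR (- (3 / 2 * L)) * S w.
    by rewrite addrC expRD ler_wpM2l ?expR_ge0.
  have [xl|xl] := lerP (l * x) (3 / 2 * L).
    have xl' : x <= 3 / 2 * l by rewrite -(ler_pM2l l0); nra.
    have : 0 <= 8 / L * (expR (- (3 / 2 * L)) * S w).
      by rewrite !mulr_ge0 ?expR_ge0// invr_ge0 ltW.
    by nra.
  have y0 : 0 <= l * x - 3 / 2 * L by rewrite subr_ge0 ltW.
  have := sqr_le_expR y0; set E := expR _ in SE *; set F := _ * S w in SE *.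
  move=> yE; have {}yE : (l * x - 3 / 2 * L) ^+ 2 <= 4 * F.
    by rewrite (le_trans yE)// ler_wpM2l.
  have : (x - 3 / 2 * l) ^+ 2 <= 4 * F / L.
    rewrite ler_pdivlMr//; apply: le_trans yE; rewrite -l2.
    by rewrite le_eqVlt; apply/orP; left; apply/eqP; ring.
  have -> : 8 / L * F = 2 * (4 * F / L) by ring.
  have : 0 <= (x - 3 * l) ^+ 2 by rewrite sqr_ge0.
  by rewrite -l2; nra.
- under eq_integral do rewrite EFinD (EFinM B).
  rewrite ge0_integralD//; last 2 first.
  + by move=> w _; rewrite mule_ge0 ?lee_fin.
  + by apply: measurable_funeM; apply/measurable_EFinP.
  rewrite integral_cst//= probability_setT mule1.
  rewrite ge0_integralZl_EFin//; last 2 first.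
  + by move=> w _; rewrite lee_fin.
  + exact/measurable_EFinP.
  (* Each exponent has variance at most [L], so each of the [2 * #|J|] exponentials has mean at most
     [expR (L / 2)]. The hypothesis on [#|J|] then bounds the mean of [B * S] by [16 * s ^ 2], and
     [9 / 2 + 16 <= 21]. *)
  have SE : (\int[P]_w (S w)%:E <= (2 * #|J|%:R * expR (L / 2))%:E)%E.
    under eq_integral do rewrite -sumEFin.
    rewrite ge0_integral_sum//; last first.
      by move=> p; apply/measurable_EFinP; exact: mZ.
    rewrite (_ : (2 * #|J|%:R * expR (L / 2)) =
        \sum_(p : bool * J) expR (L / 2)); last first.
      by rewrite sumr_const card_prod card_bool -[RHS]mulr_natr natrM; ring.
    rewrite -sumEFin; apply: lee_sum => -[b j] _ /=.
    rewrite (iid_normal_mgf s0 iidX) lee_fin ler_expR ler_wpM2r//.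
    rewrite (eq_bigr (fun k => L / s ^+ 2 * r j k ^+ 2)); last first.
      move=> k _; rewrite -l2 !exprMn exprVn; case: b; rewrite ?expr0 ?expr1; ring.
    rewrite -mulr_sumr mulrA (mulrC (s ^+ 2)) divfK ?gt_eqF ?exprn_gt0//.
    by rewrite ler_piMr// ltW.
  apply: (@le_trans _ _ (A%:E + B%:E * (2 * #|J|%:R * expR (L / 2))%:E)%E).
    by rewrite leeD2l// lee_wpmul2l// lee_fin.
  rewrite -EFinM -EFinD lee_fin /A /B.
  have -> : 8 / L * expR (- (3 / 2 * L)) * s ^+ 2 * (2 * #|J|%:R * expR (L / 2)) =
     16 * s ^+ 2 * (#|J|%:R * (expR (- (3 / 2 * L)) * expR (L / 2)) / L).
    by ring.
  rewrite -expRD (_ : - (3 / 2 * L) + L / 2 = - L); last by field.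
  have : #|J|%:R * expR (- L) / L <= 1.
    rewrite ler_pdivrMr// mul1r (le_trans _ L1)//.
    by rewrite expRN ler_pdivrMr ?expR_gt0// mul1r.
  set q := _ / L => q1; have s20 : 0 < s ^+ 2 by rewrite exprn_gt0.
  have : s ^+ 2 * q <= s ^+ 2 * L by rewrite ler_pM2l// (le_trans q1).
  have : 0 <= s ^+ 2 * L by rewrite mulr_ge0// ltW.
  by nra.
Qed.

(** The family of a single form, with [L = 1]. *)
Lemma gaussian_form_sq (r : K -> R) : \sum_k r k ^+ 2 <= 1 ->
  (\int[P]_w ((\sum_k r k * X k w) ^+ 2)%:E <= (21 * s ^+ 2)%:E)%E.
Proof.
move=> r1; have [||//|Y [_ Y0 rY]] :=
  @gaussian_forms_max unit (fun _ => r) 1.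
- by [].
- by [].
- by rewrite card_unit -expR0 ler_expR.
rewrite mulr1; apply: le_trans; apply: ge0_le_integral_nonmeas => w.
- by rewrite lee_fin sqr_ge0.
- by rewrite lee_fin; exact: rY tt.
Qed.

End GaussianMaximum.

(** * Quasi-volumes and variation *)

(** Distributivity for dependent functions: sums over a grid with unequal sides factor over its
    coordinates through it. *)
Lemma sum_prod_dffun (A : comPzSemiRingType) (I : finType) (T_ : I -> finType)
    (F : forall i, T_ i -> A) :
  \sum_(z : {dffun forall i, T_ i}) \prod_i F i (z i) =
  \prod_i \sum_(k : T_ i) F i k.
Proof.
rewrite (reindex (@dffun_of_fprod I T_)); last exact/onW_bij/dffun_of_fprod_bij.
transitivity (\sum_(t : fprod T_) \prod_(i in I) [ffun k => F i k] (t i)).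
  by apply: eq_bigr => t _; apply: eq_bigr => i _; rewrite !ffunE.
transitivity (\prod_i \sum_(j in tagged_with T_ i)
    untag 0 ([ffun k => F i k] : {ffun T_ i -> A}) j).
  rewrite bigA_distr_big_dep.
  exact: (big_fprod _ _ (fun i => [ffun k => F i k] : {ffun T_ i -> A})).
apply: eq_bigr => i _.
rewrite -(big_tag (fun i => ([ffun k => F i k] : {ffun T_ i -> A}))).
by apply: eq_bigr => k _; rewrite ffunE.
Qed.

Section QuasiVolume.
Context {R : realType} {I : finType}.
Implicit Types (a b : {ffun I -> R}) (f g : {ffun I -> R} -> R).

Lemma eq_quasi_volume f g a b :
  (forall e : {ffun I -> bool}, let u := [ffun i => b i + (e i)%:R * (a i - b i)] in
     f u = g u) ->
  quasi_volume f a b = quasi_volume g a b.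
Proof. by move=> fg; apply: eq_bigr => e _; rewrite fg. Qed.

Lemma quasi_volume_sum (J : finType) (F : J -> {ffun I -> R} -> R) a b :
  quasi_volume (fun u => \sum_j F j u) a b = \sum_j quasi_volume (F j) a b.
Proof.
rewrite /quasi_volume exchange_big/=; apply: eq_bigr => e _.
by rewrite mulr_sumr.
Qed.

Lemma quasi_volumeD f g a b :
  quasi_volume (fun u => f u + g u) a b = quasi_volume f a b + quasi_volume g a b.
Proof.
by rewrite /quasi_volume -big_split; apply: eq_bigr => e _; rewrite mulrDr.
Qed.

Lemma quasi_volumeZ c f a b :
  quasi_volume (fun u => c * f u) a b = c * quasi_volume f a b.
Proof.
by rewrite /quasi_volume mulr_sumr; apply: eq_bigr => e _; rewrite mulrCA.
Qed.

Lemma quasi_volume_prod (phi : I -> R -> R) a b :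
  quasi_volume (fun u => \prod_i phi i (u i)) a b =
  \prod_i (phi i (b i) - if a i != b i then phi i (a i) else 0).
Proof.
transitivity (\prod_i \sum_(x : bool | x ==> (a i != b i))
    (-1) ^+ x * phi i (b i + x%:R * (a i - b i))).
  rewrite bigA_distr_big_dep /quasi_volume.
  apply: eq_big => [e|e _]; first by apply/forallP/familyP => h i; exact: h.
  rewrite big_split/= -expr_sum; congr (_ * _).
  by apply: eq_bigr => i _; rewrite ffunE.
apply: eq_bigr => i _; rewrite big_mkcond big_bool/= !mul0r !addr0 !mul1r.
by case: ifP => _; rewrite ?add0r ?subr0// mulN1r subrKC addrC.
Qed.

End QuasiVolume.

Section Faces.
Context {R : realType} {I : finType}.

Lemma prod_face (S : {set I}) (phi : I -> R -> R) (u : {ffun {i | i \in S} -> R}) :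
  \prod_j phi j (oapp (fun k => u k) 0 (insub j)) =
  (\prod_(j | j \notin S) phi j 0) * \prod_(i : {i | i \in S}) phi (val i) (u i).
Proof.
rewrite (bigID (mem S))/= mulrC; congr (_ * _).
  by apply: eq_bigr => j jS; rewrite insubN.
rewrite big_sub; apply: eq_bigr => i _.
by rewrite valK.
Qed.

End Faces.

Section PartitionNodes.
Context {R : realType} {J : finType}.
Variables (s : J -> seq R) (hs : forall i, itv_partition 0 1 (s i)).

Lemma partition_node_lt (i : J) (l : 'I_(size (s i))) :
  nth 1 (0 :: s i) l < nth 1 (0 :: s i) l.+1.
Proof. by have [/(pathP 1) + _] := hs i; apply; exact: ltn_ord. Qed.

Lemma partition_corner01 (l : {dffun forall i : J, 'I_(size (s i))})
    (e : {ffun J -> bool}) i :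
  0 <= partition_node s (fun i => (l i).+1) i + (e i)%:R *
    (partition_node s (fun i => l i) i - partition_node s (fun i => (l i).+1) i) <= 1.
Proof.
have nd k : (k < (size (s i)).+1)%N -> 0 <= nth 1 (0 :: s i) k <= 1.
  move=> ks; rewrite (itv_partition_nth_ge ks (hs i)).
  by rewrite (itv_partition_nth_le ks (hs i)).
rewrite !ffunE; case: (e i); last by rewrite mul0r addr0 nd// ltnS ltn_ord.
by rewrite mul1r subrKC nd// (leq_trans (ltn_ord _)).
Qed.

End PartitionNodes.

(** On the cube [f] is affine in a product of steps. A face that misses a coordinate [j] carries the
    factor [step (xs j) 0], which is zero as [xs j > 0]; on the full cube the split sum factors into
    variations of single steps, each at most 1. *)
Lemma hk0_variation_indicator (R : realType) (I : finType) (f : {ffun I -> R} -> R)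
    (a1 a0 : R) (xs : {ffun I -> R}) :
  (forall j, 0 < xs j <= 1) ->
  (forall u, unit_cube u -> f u = a1 * \1_(closed_box xs ones) u + a0) ->
  (hk0_variation f <= `|a1|%:E)%E.
Proof.
move=> xs01 fE; pose step (x y : R) : R := (x <= y)%R%:R.
have fE' u : unit_cube u -> f u = a1 * (\prod_j step (xs j) (u j)) + a0.
  move=> cu; rewrite fE//; congr (_ * _ + _); rewrite indicE.
  case: (boolP (u \in _)) => [/set_mem bu|].
    by rewrite big1// => j _; rewrite /step; have /andP[-> _] := bu j.
  rewrite notin_setE => nb.
  have /existsNP[j nj] : ~ forall j, xs j <= u j.
    move=> h; apply: nb => j; rewrite h /=.
    by have /andP[_] := cu j; rewrite !ffunE.
  by rewrite (bigD1 j)//= /step; move/negP/negbTE: nj => ->; rewrite mul0r.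
pose c (S : {set I}) := a1 * \prod_(j | j \notin S) step (xs j) 0.
have vS S : S != finset.set0 ->
    (vitali_variation (face_restriction (S := S) f) <= `|c S|%:E)%E.
  move=> /set0Pn[i0 i0S]; apply: ge_ereal_sup => _ [s hs <-]; rewrite lee_fin.
  pose nd i k := nth 1 (0 :: s i) k.
  pose D i (k : 'I_(size (s i))) : R :=
    step (xs (val i)) (nd i k.+1) - step (xs (val i)) (nd i k).
  have qv (l : {dffun forall i, 'I_(size (s i))}) :
      quasi_volume (face_restriction (S := S) f)
        (partition_node s (fun i => l i)) (partition_node s (fun i => (l i).+1)) =
      c S * \prod_i D i (l i).
    (* The constant is written as a product so that [quasi_volume_prod] cancels it: a nonempty face
       has a coordinate, and the cells have distinct end points there. *)
    pose F (u : {ffun {i | i \in S} -> R}) :=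
      c S * (\prod_i step (xs (val i)) (u i)) + a0 * \prod_(i : {i | i \in S}) 1.
    rewrite (@eq_quasi_volume _ _ _ F); last first.
      move=> e u; rewrite /face_restriction fE'; last first.
        move=> j; rewrite !ffunE; case: insubP => [k _ _|_]/=; last by rewrite lexx ler01.
        by rewrite ffunE; exact: partition_corner01.
      under eq_bigr do rewrite ffunE.
      by rewrite (prod_face (fun j => step (xs j))) /F mulrA big1_eq mulr1.
    have lneq i : partition_node s (fun i => l i) i !=
                  partition_node s (fun i => (l i).+1) i.
      by rewrite !ffunE lt_eqF// partition_node_lt.
    rewrite quasi_volumeD !quasi_volumeZ.
    rewrite (quasi_volume_prod (fun i => step (xs (val i)))).
    rewrite (quasi_volume_prod (fun i x => 1)).
    rewrite [X in _ + _ * X](bigD1 (exist _ i0 i0S))//= lneq subrr mul0r mulr0 addr0.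
    by congr (_ * _); apply: eq_bigr => i _; rewrite lneq !ffunE.
  rewrite /split_sum; under eq_bigr do rewrite qv normrM normr_prod.
  rewrite -mulr_sumr (sum_prod_dffun (fun i k => `|D i k|)).
  rewrite ler_piMr// prodr_ile1// => i _.
  rewrite sumr_ge0//=.
  have stepM x y z : y <= z -> step x y <= step x z.
    rewrite /step ler_nat => yz; case: (boolP (x <= y)) => // xy.
    by rewrite (le_trans xy yz).
  have -> : \sum_(k < size (s i)) `|D i k| =
      \sum_(0 <= k < size (s i)) (step (xs (val i)) (nd i k.+1) - step (xs (val i)) (nd i k)).
    rewrite big_mkord; apply: eq_bigr => k _; rewrite ger0_norm// subr_ge0 stepM//.
    exact: ltW (partition_node_lt hs k).
  rewrite telescope_sumr// /step.
  by rewrite lerBlDr (@le_trans _ _ 1) ?lerDl ?ler0n// lern1 leq_b1.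
rewrite /hk0_variation.
apply: (@le_trans _ _ (\sum_(S : {set I} | S != finset.set0) `|c S|%:E)%E).
  exact: lee_sum.
rewrite sumEFin lee_fin.
apply: (@le_trans _ _ (\sum_(S : {set I}) `|c S|)).
  by rewrite [leRHS](bigID (fun S => S != finset.set0))/= lerDl sumr_ge0.
rewrite (bigD1 [set: I]%SET)//= big1 ?addr0.
  by rewrite /c big_pred0 ?mulr1// => j; rewrite finset.in_setT.
move=> S ST; have [j _ jS] : exists2 j, j \in [set: I]%SET & j \notin S.
  by apply/subsetPn; rewrite finset.subTset.
rewrite /c (bigD1 j)//= /step leNgt; have /andP[-> _] := xs01 j.
by rewrite mul0r mulr0 normr0.
Qed.

(** * Mixed differences on the lattice *)

Section MixedDifferences.
Context {R : realType} {I : finType}.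
Variable ns : I -> nat.

Definition grid : finType := {dffun forall i : I, 'I_(ns i)}.
Implicit Types (y z : grid).

Definition grid_point z : {ffun I -> R} := [ffun j => (z j)%:R / (ns j)%:R].

Definition grid_support z : {set I} := [set j | (z j != 0 :> nat)]%SET.

(* The mixed backward difference of [theta], extended by zero below the grid,
   written through its kernel. *)
Definition mixed_diff (theta : grid -> R) z : R :=
  \sum_y theta y * \prod_j ((z j == y j :> nat)%:R - (z j == (y j).+1 :> nat)%:R).

(** Summing the kernel over [z j <= i j] leaves [[y j <= i j] - [(y j).+1 <= i j] = [y j = i j]] in
    each coordinate. *)
Lemma sum_mixed_diff (theta : grid -> R) (i : grid) :
  \sum_z mixed_diff theta z * \prod_j (z j <= i j)%N%:R = theta i.
Proof.
transitivity (\sum_y theta y * \prod_j ((y j == i j :> nat)%:R : R)).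
  under eq_bigr do rewrite /mixed_diff mulr_suml.
  rewrite exchange_big/=; apply: eq_bigr => y _.
  under eq_bigr do rewrite -mulrA -big_split/=.
  rewrite -mulr_sumr (sum_prod_dffun (fun j (k : 'I_(ns j)) =>
    (((k == y j :> nat)%:R - (k == (y j).+1 :> nat)%:R) * (k <= i j)%N%:R : R))).
  congr (_ * _); apply: eq_bigr => j _.
  under eq_bigr do rewrite mulrBl.
  rewrite sumrB.
  (* [m = (y j).+1] may be [ns j], beyond the grid; both sides are then zero. *)
  have E m : \sum_(k < ns j) (k == m :> nat)%:R * (k <= i j)%N%:R = (m <= i j)%N%:R :> R.
    have [mn|mn] := ltnP m (ns j); last first.
      rewrite leqNgt (leq_trans (ltn_ord _) mn) big1// => k _.
      by rewrite ltn_eqF ?mul0r// (leq_trans (ltn_ord _) mn).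
    rewrite (bigD1 (Ordinal mn))//= eqxx mul1r big1 ?addr0// => k kN.
    by rewrite -val_eqE/= in kN; rewrite (negbTE kN) mul0r.
  rewrite !E; case: ltngtP => //=; rewrite ?subrr ?subr0//.
rewrite (bigD1 i)//= big1 ?mulr1; last by move=> j _; rewrite eqxx.
rewrite big1 ?addr0// => y yi.
suff [j ij] : exists j, y j != i j.
  by rewrite (bigD1 j)//= val_eqE (negbTE ij) mul0r mulr0.
apply/existsP; apply: contraR yi; rewrite negb_exists => /forallP h.
by apply/eqP/ffunP => j; have := h j; rewrite negbK => /eqP.
Qed.

Hypothesis ns1 : forall j, (1 <= ns j)%N.

Let nsR j : (ns j)%:R != 0 :> R.
Proof. by rewrite pnatr_eq0 -lt0n. Qed.

(** The last cut is 1, as a partition of the unit interval requires, but it is not a lattice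
    coordinate. *)
Let cuts j : seq R := mkseq (fun k => k.+1%:R / (ns j)%:R) (ns j).

Let cuts_nth j k : (k <= ns j)%N -> nth 1 (0 :: cuts j) k = k%:R / (ns j)%:R.
Proof. by case: k => [_|k kn]; rewrite ?mul0r//= nth_mkseq. Qed.

Let cuts_partition j : itv_partition 0 1 (cuts j).
Proof.
have sz : size (cuts j) = ns j by rewrite size_mkseq.
split.
  apply/(pathP 1) => k; rewrite sz => kn.
  rewrite cuts_nth ?(ltnW kn)// nth_mkseq//.
  by rewrite ltr_pM2r ?invr_gt0 ?ltr0n// ltr_nat.
rewrite (last_nth 1) sz cuts_nth// divff//.
Qed.

(** Where [z j = 0] the difference extended by zero is evaluation at 0, that is, restriction to a
    face. In the coordinates of the support it is the difference over the lattice cell with upper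
    corner [z], whose index is [(z j).-1]. *)
Lemma mixed_diff_face (g : {ffun I -> R} -> R) z (S := grid_support z)
    (s := fun i : {i | i \in S} => cuts (val i)) :
  mixed_diff (g \o grid_point) z =
  quasi_volume (face_restriction (S := S) g)
    (partition_node s (fun i => (z (val i)).-1))
    (partition_node s (fun i => (z (val i)).-1.+1)).
Proof.
have zS (i : {i | i \in S}) : (0 < z (val i))%N.
  by have := valP i; rewrite inE lt0n.
pose pick (x : R) j (k : nat) : R := (x == k%:R / (ns j)%:R)%:R.
(* [F] expands [g] in products of point indicators at lattice points. It agrees with the face
   restriction at the corners of the cell, and [quasi_volume_prod] applies to it term by term. *)
pose F (u : {ffun {i | i \in S} -> R}) := \sum_y g (grid_point y) *
  (\prod_(j | j \notin S) pick 0 j (y j)) * \prod_i pick (u i) (val i) (y (val i)).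
pose b := partition_node s (fun i => (z (val i)).-1.+1).
pose a := partition_node s (fun i => (z (val i)).-1).
have bE i : b i = (z (val i))%:R / (ns (val i))%:R.
  by rewrite ffunE cuts_nth ?prednK ?zS// ltnW.
have aE i : a i = (z (val i)).-1%:R / (ns (val i))%:R.
  by rewrite ffunE cuts_nth// (leq_trans (leq_pred _))// ltnW.
have eqdiv j (k m : nat) : (k%:R / (ns j)%:R == m%:R / (ns j)%:R :> R) = (k == m).
  by rewrite (inj_eq (mulIf _)) ?invr_eq0// eqr_nat.
rewrite -/a -/b (@eq_quasi_volume _ _ _ F); last first.
  move=> e u; rewrite /face_restriction /F.
  pose t j : nat := oapp (fun k => z (val k) - e k)%N 0%N (insub j).
  have tn j : (t j < ns j)%N.
    by rewrite /t; case: insubP => [k _ <-|_]//=; rewrite (leq_ltn_trans (leq_subr _ _)).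
  pose v : grid := [ffun j => Ordinal (tn j)].
  have vE : grid_point v = [ffun j => oapp (fun k => u k) 0 (insub j)].
    apply/ffunP => j; rewrite !ffunE /= /t; case: insubP => [k _ <-|_]/=; last by rewrite mul0r.
    rewrite ffunE bE aE; case: (e k); last by rewrite mul0r addr0 subn0.
    by rewrite mul1r subrKC subn1.
  rewrite -vE (bigD1 v)//= [X in _ = X + _](_ : _ = g (grid_point v)).
    rewrite big1 ?addr0// => y yv; rewrite -mulrA -(prod_face (fun j x => pick x j (y j))).
    suff [j ij] : exists j, y j != v j.
      rewrite (bigD1 j)//= /pick; have := congr1 (fun w : {ffun I -> R} => w j) vE.
      rewrite !ffunE => <-; rewrite eqdiv eq_sym.
      by move: ij; rewrite -val_eqE/= ffunE/= => /negbTE ->; rewrite mul0r mulr0.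
    apply/existsP; apply: contraR yv; rewrite negb_exists => /forallP h.
    by apply/eqP/ffunP => j; have := h j; rewrite negbK => /eqP.
  rewrite -mulrA -(prod_face (fun j x => pick x j (v j))) big1 ?mulr1// => j _.
  have := congr1 (fun w : {ffun I -> R} => w j) vE.
  by rewrite !ffunE => <-; rewrite /pick eqxx.
rewrite quasi_volume_sum /mixed_diff; apply: eq_bigr => y _.
rewrite quasi_volumeZ -mulrA; congr (_ * _).
rewrite (quasi_volume_prod (fun i x => pick x (val i) (y (val i)))).
rewrite (bigID (mem S))/= mulrC; congr (_ * _).
  apply: eq_bigr => j; rewrite inE negbK => /eqP ->.
  by have := eqdiv j 0%N (y j); rewrite mul0r /pick => ->; rewrite subr0.
rewrite big_sub; apply: eq_bigr => i _.
have ab : a i != b i.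
  by rewrite aE bE eqdiv -(prednK (zS i)) neq_ltn ltnSn.
rewrite ab /pick aE bE !eqdiv; congr (_ - (_ : bool)%:R).
by rewrite -{1}(prednK (zS i)) eqSS.
Qed.

(** The coefficients are grouped by support. Those of support [S] are quasi-volumes of distinct
    cells of the lattice split of the face [S], so their absolute values add up to at most one split
    sum. *)
Lemma mixed_diff_le_hk0 (g : {ffun I -> R} -> R) :
  ((\sum_(z | grid_support z != finset.set0) `|mixed_diff (g \o grid_point) z|)%:E
     <= hk0_variation g)%E.
Proof.
rewrite (partition_big grid_support (fun S => S != finset.set0))//=.
rewrite -sumEFin; apply: lee_sum => S SN0.
pose s := fun i : {i | i \in S} => cuts (val i).
apply: (@le_trans _ _ (split_sum (face_restriction (S := S) g) s)%:E); last first.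
  by apply: ereal_sup_ubound; exists s => // i; exact: cuts_partition.
rewrite lee_fin (eq_bigl (fun z => grid_support z == S)); last first.
  by move=> z; case: (grid_support z =P S) => [->|_]; rewrite ?SN0// andbF.
have kn z i : ((z (val i)).-1 < size (s i))%N.
  by rewrite size_mkseq (leq_ltn_trans (leq_pred _)).
pose h z : {dffun forall i, 'I_(size (s i))} := [ffun i => Ordinal (kn z i)].
pose q (l : {dffun forall i, 'I_(size (s i))}) :=
  `|quasi_volume (face_restriction (S := S) g) (partition_node s (fun i => l i))
      (partition_node s (fun i => (l i).+1))|.
have hE z : grid_support z == S -> `|mixed_diff (g \o grid_point) z| = q (h z).
  move=> /eqP zS; subst S; rewrite mixed_diff_face /q.
  by congr (`|quasi_volume _ _ _|); apply/ffunP => i; rewrite !ffunE.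
rewrite (eq_bigr _ hE) (eq_bigl (mem [set z | grid_support z == S]%SET)); last first.
  by move=> z; rewrite !inE.
rewrite -big_imset/=; last first.
  move=> z z'; rewrite !inE => /eqP zS /eqP z'S hzz'.
  apply/ffunP => j; apply/val_inj => /=.
  have [jS|jS] := boolP (j \in S).
    have := congr1 (fun l : {dffun forall i, 'I_(size (s i))} =>
      l (exist _ j jS) : nat) hzz'.
    rewrite !ffunE /= => zz'.
    have zj : (0 < z j)%N by move: jS; rewrite -zS inE lt0n.
    have z'j : (0 < z' j)%N by move: jS; rewrite -z'S inE lt0n.
    by rewrite -(prednK zj) zz' prednK.
  have := jS; rewrite -{1}zS inE negbK => /eqP ->.
  by move: jS; rewrite -z'S inE negbK => /eqP ->.
rewrite /split_sum -[leRHS]/(\sum_l q l).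
by rewrite [leRHS](bigID (mem (finset.imset h (mem [set z | grid_support z == S]%SET))))/=
  lerDl sumr_ge0// => l _; exact: normr_ge0.
Qed.

End MixedDifferences.

(** * Convexity of the variation *)

Lemma vitali_variation_midpoint (R : realType) (I : finType)
    (f g : {ffun I -> R} -> R) :
  (vitali_variation (fun u => 2^-1 * (f u + g u))%R <=
   (2^-1)%:E * (vitali_variation f + vitali_variation g))%E.
Proof.
apply: ge_ereal_sup => _ [s hs <-].
apply: (@le_trans _ _ ((2^-1)%:E * ((split_sum f s)%:E + (split_sum g s)%:E))%E).
  rewrite -EFinD -EFinM lee_fin /split_sum -big_split/= mulr_sumr.
  apply: ler_sum => l _; rewrite quasi_volumeZ quasi_volumeD normrM ger0_norm//.
  by rewrite ler_wpM2l// ler_normD.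
apply: lee_wpmul2l; first by rewrite lee_fin.
by apply: leeD; apply: ereal_sup_ubound; exists s.
Qed.

Lemma vitali_variation_ge0 (R : realType) (I : finType) (f : {ffun I -> R} -> R) :
  (0 <= vitali_variation f)%E.
Proof.
apply: (@le_trans _ _ (split_sum f (fun=> [:: 1]))%:E).
  by rewrite lee_fin sumr_ge0.
by apply: ereal_sup_ubound; exists (fun=> [:: 1]) => // i; exact: itv_partition1.
Qed.

(** Makes the midpoint of the estimator and a competitor feasible. *)
Lemma hk0_variation_midpoint (R : realType) (I : finType)
    (f g : {ffun I -> R} -> R) (V : R) :
  (hk0_variation f <= V%:E)%E -> (hk0_variation g <= V%:E)%E ->
  (hk0_variation (fun u => 2^-1 * (f u + g u))%R <= V%:E)%E.
Proof.
move=> fV gV.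
apply: (@le_trans _ _ ((2^-1)%:E * (hk0_variation f + hk0_variation g))%E).
  rewrite /hk0_variation -big_split/= ge0_sume_distrr; last first.
    by move=> S _; rewrite adde_ge0 ?vitali_variation_ge0.
  by apply: lee_sum => S _; exact: vitali_variation_midpoint.
apply: (@le_trans _ _ ((2^-1)%:E * (V%:E + V%:E))%E).
  by apply: lee_wpmul2l; [rewrite lee_fin|exact: leeD].
by rewrite -EFinD -EFinM lee_fin le_eqVlt; apply/orP; left; apply/eqP; field.
Qed.

(** * Block averages and the cone *)

(** Twice the hypothesis, expanded. Comparing the estimator with the midpoint rather than with [t]
    produces the negative quadratic term, which later absorbs the noise. *)
Lemma midpoint_basic_inequality (R : realType) (G : finType) (t that tstar xi : G -> R) :
  \sum_i (tstar i + xi i - that i) ^+ 2 <=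
    \sum_i (tstar i + xi i - 2^-1 * (that i + t i)) ^+ 2 ->
  \sum_i (that i - tstar i) ^+ 2 <= \sum_i (t i - tstar i) ^+ 2 +
    (2 * \sum_i xi i * (that i - t i) - 2^-1 * \sum_i (that i - t i) ^+ 2).
Proof.
rewrite -subr_ge0 => h; rewrite -subr_ge0 !mulr_sumr.
rewrite -sumrB -big_split/= -sumrB.
rewrite -sumrB in h.
rewrite (eq_bigr (fun i => 2 * ((tstar i + xi i - 2^-1 * (that i + t i)) ^+ 2 -
  (tstar i + xi i - that i) ^+ 2))); last by move=> i _; field.
by rewrite -mulr_sumr mulr_ge0.
Qed.

Section BlockAverages.
Context {R : realType} {G Lab : finType}.
Variable lab : G -> Lab.
Implicit Types (x u xi : G -> R) (B : Lab).

Definition block_size B : R := #|[pred i | lab i == B]|%:R.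
Definition block_sum x B : R := \sum_(i | lab i == B) x i.
(** For an empty block this is [0 / 0 = 0], and such a block contributes nothing to the weighted
    sums below. *)
Definition block_avg x B : R := block_sum x B / block_size B.

Lemma block_size_gt0 i : 0 < block_size (lab i).
Proof. by rewrite ltr0n; apply/card_gt0P; exists i; rewrite inE. Qed.

Lemma block_avg_mul x B : block_size B * block_avg x B = block_sum x B.
Proof.
have [B0|B0] := eqVneq (block_size B) 0; last by rewrite mulrCA divff ?mulr1.
rewrite B0 mul0r /block_sum big1// => i /eqP iB.
by have := block_size_gt0 i; rewrite iB B0 ltxx.
Qed.

Lemma sum_by_blocks (F : G -> R) : \sum_i F i = \sum_B \sum_(i | lab i == B) F i.
Proof. exact: partition_big. Qed.

(** Pythagoras in one block: the average is the projection on constants. *)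
Lemma block_sqr_dist x (c : R) B :
  \sum_(i | lab i == B) (x i - c) ^+ 2 =
  \sum_(i | lab i == B) (x i - block_avg x B) ^+ 2 +
  block_size B * (block_avg x B - c) ^+ 2.
Proof.
have E (a : R) : \sum_(i | lab i == B) (x i - a) ^+ 2 =
    \sum_(i | lab i == B) x i ^+ 2 - 2 * a * (block_size B * block_avg x B)
      + block_size B * a ^+ 2.
  rewrite block_avg_mul /block_sum mulr_sumr -sumrB.
  rewrite (_ : block_size B * a ^+ 2 = \sum_(i | lab i == B) a ^+ 2).
    by rewrite -big_split/=; apply: eq_bigr => i _; ring.
  by rewrite sumr_const mulr_natl.
by rewrite !E; ring.
Qed.

Lemma block_avg_best x u :
  (forall i j, lab i = lab j -> u i = u j) ->
  \sum_i (x i - block_avg x (lab i)) ^+ 2 <= \sum_i (x i - u i) ^+ 2.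
Proof.
move=> ucst; rewrite !sum_by_blocks; apply: ler_sum => B _.
have [i0 /eqP i0B|none] := pickP (fun i => lab i == B); last first.
  by rewrite !big_pred0.
rewrite [leRHS](eq_bigr (fun i => (x i - u i0) ^+ 2)); last first.
  by move=> i /eqP iB; rewrite (ucst i i0)// iB i0B.
rewrite block_sqr_dist (eq_bigr (fun i => (x i - block_avg x B) ^+ 2)); last first.
  by move=> i /eqP ->.
by rewrite lerDl mulr_ge0 ?sqr_ge0.
Qed.

Lemma block_avg_sq x : \sum_B block_size B * block_avg x B ^+ 2 <= \sum_i x i ^+ 2.
Proof.
rewrite [leRHS]sum_by_blocks; apply: ler_sum => B _.
have := block_sqr_dist x 0 B; under eq_bigr do rewrite subr0.
by move=> ->; rewrite subr0 lerDr sumr_ge0// => i _; exact: sqr_ge0.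
Qed.

Lemma block_decomp x xi :
  \sum_i xi i * x i = \sum_B block_sum xi B * block_avg x B +
                      \sum_i xi i * (x i - block_avg x (lab i)).
Proof.
rewrite [X in _ = _ + X]sum_by_blocks -big_split/= sum_by_blocks.
apply: eq_bigr => B _; rewrite /block_sum mulr_suml -big_split/=.
by apply: eq_bigr => i /eqP ->; ring.
Qed.

(** Young's inequality [2 * a * b <= 4 * a ^ 2 + b ^ 2 / 4], weighted by the block sizes. It spends
    half of the negative quadratic term of the basic inequality. *)
Lemma block_inner_le x xi :
  2 * \sum_B block_sum xi B * block_avg x B <=
  4 * \sum_B block_sum xi B ^+ 2 / block_size B + 4^-1 * \sum_i x i ^+ 2.
Proof.
apply: (@le_trans _ _ (4 * \sum_B block_sum xi B ^+ 2 / block_size B +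
    4^-1 * \sum_B block_size B * block_avg x B ^+ 2)); last first.
  by rewrite lerD2l ler_wpM2l// block_avg_sq.
rewrite !mulr_sumr -big_split/=; apply: ler_sum => B _.
rewrite -(block_avg_mul xi); set m := block_size B.
set a := block_avg xi B; set b := block_avg x B.
have [->|m0] := eqVneq m 0; first by rewrite !mul0r expr0n/= !mul0r !mulr0 addr0.
have m1 : 0 < m by rewrite lt_def m0 ler0n.
rewrite (_ : (m * a) ^+ 2 / m = m * a ^+ 2); last by field.
have : 0 <= m * (2 * a - 2^-1 * b) ^+ 2 by rewrite mulr_ge0 ?sqr_ge0// ltW.
by nra.
Qed.

End BlockAverages.

(* [z0] indexes the unpenalised constant and [zs] the active coefficient, and
   [q] is the dual certificate: [q zs = 1], [q z0 = 0], [q = X psi]. *)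
Lemma cone_noise_bound (R : realType) (G Lab : finType) (lab : G -> Lab)
    (X : G -> G -> R) (b h xi psi q : G -> R) (z0 zs : G) (s m : R) :
  (forall i, h i = \sum_z b z * X z i) ->
  s * b zs + \sum_(z | (z != z0) && (z != zs)) `|b z| <= 0 ->
  `|s| = 1 -> 0 <= m -> z0 != zs ->
  (forall z, \sum_i psi i * X z i = q z) ->
  (forall z, 0 <= q z <= 1) -> q z0 = 0 -> q zs = 1 ->
  \sum_i xi i * (X z0 i - block_avg lab (X z0) (lab i)) = 0 ->
  (forall z, `|\sum_i xi i * (X z i - block_avg lab (X z) (lab i))| <= m * (1 - q z)) ->
  2 * (\sum_i xi i * h i) - 2^-1 * \sum_i h i ^+ 2 <=
  4 * (\sum_B block_sum lab xi B ^+ 2 / block_size lab B) +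
  4 * m ^+ 2 * \sum_i psi i ^+ 2.
Proof.
move=> hE cone s1 m0 z0s psiX q01 qz0 qzs r0 rle.
rewrite (block_decomp lab) mulrDr.
have H1 := block_inner_le lab h xi.
pose rho z := \sum_i xi i * (X z i - block_avg lab (X z) (lab i)).
have avgh i : block_avg lab h (lab i) = \sum_z b z * block_avg lab (X z) (lab i).
  rewrite /block_avg /block_sum; under eq_bigr do rewrite hE.
  by rewrite exchange_big/= mulr_suml; apply: eq_bigr => z _; rewrite -mulr_sumr mulrA.
have E2 : \sum_i xi i * (h i - block_avg lab h (lab i)) = \sum_z b z * rho z.
  under eq_bigr do rewrite avgh hE -sumrB mulr_sumr.
  rewrite exchange_big/=; apply: eq_bigr => z _; rewrite /rho mulr_sumr.
  by apply: eq_bigr => i _; ring.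
have E3 : \sum_i psi i * h i = \sum_z b z * q z.
  under eq_bigr do rewrite hE mulr_sumr.
  rewrite exchange_big/=; apply: eq_bigr => z _; rewrite -psiX mulr_sumr.
  by apply: eq_bigr => i _; ring.
have sq : s * s = 1 by rewrite -expr2 -real_normK ?num_real// s1 expr1n.
(* [rho] vanishes at [z0] and [zs], and elsewhere [|rho z| <= m * (1 - q z)]. The cone bounds the
   sum of the [|b z|] by [- s * b zs], and [- |b z| * q z <= - s * b z * q z]. *)
have H2 : \sum_z b z * rho z <= m * (- s * \sum_z b z * q z).
  have rs : rho zs = 0.
    by apply/eqP; rewrite -normr_le0 (le_trans (rle zs))// qzs subrr mulr0.
  rewrite (bigD1 z0)//= [rho z0]r0 mulr0 add0r (bigD1 zs) 1?eq_sym//= rs mulr0 add0r.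
  rewrite [X in _ <= _ * (_ * X)](bigD1 z0)//= qz0 mulr0 add0r.
  rewrite [X in _ <= _ * (_ * X)](bigD1 zs) 1?eq_sym//= qzs mulr1.
  apply: (@le_trans _ _ (m * \sum_(z | (z != z0) && (z != zs)) `|b z| * (1 - q z))).
    rewrite mulr_sumr; apply: ler_sum => z _; apply: (le_trans (ler_norm _)).
    by rewrite normrM mulrCA ler_wpM2l// rle.
  rewrite ler_wpM2l//.
  have H : - s * \sum_(z | (z != z0) && (z != zs)) b z * q z >=
      - \sum_(z | (z != z0) && (z != zs)) `|b z| * q z.
    rewrite mulr_sumr -sumrN; apply: ler_sum => z _.
    have /andP[qz _] := q01 z.
    rewrite mulrA -mulNr ler_wpM2r// mulNr lerN2 (le_trans (ler_norm _))//.
    by rewrite normrM s1 mul1r.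
  rewrite (eq_bigr (fun z => `|b z| - `|b z| * q z)); last by move=> z _; ring.
  rewrite sumrB mulrDr; move: H cone; set A := \sum_(_ | _) _; set B := \sum_(_ | _) _.
  by rewrite mulNr; nra.
(* By [E3] the sum is the inner product of [psi] and [h], and Young's inequality spends the other
   half of the quadratic term. *)
have H3 : 2 * (m * (- s * \sum_z b z * q z)) <=
    4 * m ^+ 2 * (\sum_i psi i ^+ 2) + 4^-1 * \sum_i h i ^+ 2.
  rewrite -E3 !mulr_sumr -big_split/=; apply: ler_sum => i _.
  have := sqr_ge0 (2 * m * psi i + 2^-1 * (s * h i)).
  have : (s * h i) ^+ 2 = h i ^+ 2 by rewrite exprMn expr2 sq mul1r.
  by nra.
rewrite E2; lra.
Qed.

(** * The one-dimensional profile and blocks *)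

Section Profile.
Context {R : realType}.
Variables (n zs : nat).
Hypotheses (zs0 : (0 < zs)%N) (zsn : (zs < n)%N).

(** The distance to [zs] is rescaled on each side to reach 1 at 0 and at [n], one past the last
    index. With the square root, [(1 - profile k) ^ 2] is linear in the distance while the squared
    increments decay like its inverse, hence sum to a logarithm. *)
Definition profile (k : nat) : R :=
  if (k < zs)%N then 1 - Num.sqrt ((zs - k)%:R / zs%:R)
  else 1 - Num.sqrt ((k - zs)%:R / (n - zs)%:R).

Definition profile_diff (k : nat) : R := profile k - profile k.+1.

Let zsR : 0 < zs%:R :> R. Proof. by rewrite ltr0n. Qed.
Let nzR : 0 < (n - zs)%:R :> R. Proof. by rewrite ltr0n subn_gt0. Qed.

Lemma profile0 : profile 0 = 0.
Proof. by rewrite /profile zs0 subn0 divff ?gt_eqF// sqrtr1 subrr. Qed.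

Lemma profile_peak : profile zs = 1.
Proof. by rewrite /profile ltnn subnn mul0r sqrtr0 subr0. Qed.

Lemma profile_end : profile n = 0.
Proof. by rewrite /profile ltnNge (ltnW zsn)/= divff ?gt_eqF// sqrtr1 subrr. Qed.

Lemma profile_le1 k : profile k <= 1.
Proof. by rewrite /profile; case: ifP => _; rewrite lerBlDr lerDl sqrtr_ge0. Qed.

Lemma profile_ge0 k : (k <= n)%N -> 0 <= profile k.
Proof.
move=> kn; rewrite /profile; case: ifP => kz; rewrite subr_ge0 -[leRHS]sqrtr1 ler_wsqrtr//.
  by rewrite ler_pdivrMr// mul1r ler_nat leq_subr.
by rewrite ler_pdivrMr// mul1r ler_nat leq_sub2r.
Qed.

Lemma sqr_1Bprofile_ge k : (k <= n)%N ->
  `|k%:R - zs%:R| / n%:R <= (1 - profile k) ^+ 2.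
Proof.
move=> kn; rewrite /profile.
have n0 : 0 < n%:R :> R by rewrite ltr0n (leq_trans _ zsn).
case: ltnP => kz; rewrite subKr sqr_sqrtr ?divr_ge0//.
  rewrite ler0_norm; last by rewrite subr_le0 ler_nat ltnW.
  rewrite opprB -natrB; last exact: ltnW.
  apply: ler_wpM2l; first exact: ler0n.
  by rewrite lef_pV2 ?posrE// ler_nat ltnW.
rewrite ger0_norm; last by rewrite subr_ge0 ler_nat.
rewrite -natrB//; apply: ler_wpM2l; first exact: ler0n.
by rewrite lef_pV2 ?posrE// ler_nat leq_subr.
Qed.

Lemma sum_profile_diff k : (k <= n)%N ->
  \sum_(i < n) profile_diff i * (k <= i)%N%:R = profile k.
Proof.
move=> kn; rewrite -(big_mkord predT (fun i => profile_diff i * (k <= i)%N%:R)).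
rewrite (big_cat_nat (leq0n k) kn)/= big1_seq ?add0r; last first.
  by move=> i /=; rewrite mem_index_iota => /andP[_ ik]; rewrite leqNgt ik mulr0.
rewrite (eq_big_nat _ _ (F2 := fun i => - (profile i.+1 - profile i))); last first.
  by move=> i /andP[ki _]; rewrite ki mulr1 opprB.
by rewrite sumrN telescope_sumr// profile_end sub0r opprK.
Qed.

(** With [a] and [b] the two roots, [(a - b) * a <= (a - b) * (a + b) = 1]. *)
Lemma sqrtr_succB_sqr (k : nat) :
  (Num.sqrt k.+1%:R - Num.sqrt k%:R) ^+ 2 <= k.+1%:R^-1 :> R.
Proof.
set a := Num.sqrt k.+1%:R; set b := Num.sqrt k%:R.
have a0 : 0 < a by rewrite sqrtr_gt0 ltr0n.
have b0 : 0 <= b by rewrite sqrtr_ge0.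
have aE : a ^+ 2 = k.+1%:R by rewrite sqr_sqrtr.
have bE : b ^+ 2 = k%:R by rewrite sqr_sqrtr.
have ab : a ^+ 2 = b ^+ 2 + 1 by rewrite aE bE -natr1.
have le_ba : b <= a by rewrite /a /b ler_wsqrtr// ler_nat.
rewrite -aE -[leRHS]mul1r ler_pdivlMr ?exprn_gt0// -exprMn.
rewrite expr_le1//; last by rewrite mulr_ge0 ?subr_ge0// ltW.
by nra.
Qed.

(** The induction step is [1 / (m + 2) <= ln ((m + 2) / (m + 1))], which is [ln (1 + x) <= x] at
    [x = - 1 / (m + 2)]. *)
Lemma harmonic_le (m : nat) : (0 < m)%N ->
  \sum_(k < m) k.+1%:R^-1 <= ln (expR 1 * m%:R) :> R.
Proof.
move=> m0; rewrite lnM ?posrE ?expR_gt0 ?ltr0n// expRK.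
case: m m0 => // m _; elim: m => [|m IH].
  by rewrite big_ord_recl big_ord0 addr0 invr1 lerDl ln_ge0.
rewrite big_ord_recr/=; apply: (le_trans (lerD IH (lexx _))).
rewrite -addrA lerD2l -lerBrDl -[leRHS]ln_div ?posrE ?ltr0n//.
have x0 : 0 < m.+1%:R / m.+2%:R :> R by rewrite divr_gt0 ?ltr0n.
have := @le_ln1Dx R (m.+1%:R / m.+2%:R - 1).
rewrite subrKC ltrBrDl subrr => /(_ x0).
rewrite -[ln (_.+1%:R / _)]opprK -lnV ?posrE// invf_div lerNl opprB => h.
apply: le_trans h; rewrite le_eqVlt; apply/orP; left; apply/eqP.
have -> : m.+1%:R = m.+2%:R - 1 :> R by rewrite -(natr1 m.+1) addrK.
by rewrite mulrBl divff ?pnatr_eq0// mul1r subKr.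
Qed.

(** At distance [i] from the peak, on a side of length [m], the increment is [(Num.sqrt i.+1 -
    Num.sqrt i) / Num.sqrt m] up to sign. Its square is at most [1 / (i.+1 * m)], and each side
    gives a harmonic sum. *)
Lemma sum_profile_diff_sqr :
  \sum_(i < n) profile_diff i ^+ 2 <=
  (zs%:R^-1 + (n - zs)%:R^-1) * ln (expR 1 * n%:R).
Proof.
have up m k : (0 < m)%N -> Num.sqrt (k%:R / m%:R) = Num.sqrt k%:R / Num.sqrt m%:R :> R.
  by move=> m0; rewrite sqrtrM// sqrtrV.
have sqm m : Num.sqrt m%:R ^+ 2 = m%:R :> R by rewrite sqr_sqrtr.
have H m : (0 < m)%N -> (m <= n)%N ->
    \sum_(k < m) (k.+1%:R^-1 / m%:R) <= m%:R^-1 * ln (expR 1 * n%:R) :> R.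
  move=> m0 mn; rewrite -mulr_suml mulrC ler_wpM2l ?invr_ge0//.
  apply: (le_trans (harmonic_le m0)).
  by rewrite ler_ln ?posrE ?mulr_gt0 ?expR_gt0 ?ltr0n ?ler_pM2l ?expR_gt0 ?ler_nat// (leq_trans m0).
rewrite -(big_mkord predT (fun i => profile_diff i ^+ 2)).
rewrite (big_cat_nat (leq0n zs) (ltnW zsn))/= mulrDl; apply: lerD.
  apply: le_trans (H _ zs0 (ltnW zsn)).
  (* The left side is read backwards from the peak. At [i = 0] the upper neighbour is the peak
     itself, where the other branch of [profile] gives the same value. *)
  rewrite big_mkord (reindex_inj rev_ord_inj)/=; apply: ler_sum => i _.
  have iz := ltn_ord i.
  rewrite /profile_diff /profile ltn_subrL zs0/=.
  have -> : (zs - (zs - i.+1) = i.+1)%N by rewrite subKn.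
  have -> : (if ((zs - i.+1).+1 < zs)%N
     then 1 - Num.sqrt ((zs - (zs - i.+1).+1)%:R / zs%:R)
     else 1 - Num.sqrt (((zs - i.+1).+1 - zs)%:R / (n - zs)%:R)) =
     1 - Num.sqrt (i%:R / zs%:R) :> R.
    rewrite subnSK//; case: (posnP i) => [->|i0].
      by rewrite subn0 ltnn subnn !mul0r.
    by rewrite ltn_subrL i0 zs0 subKn 1?ltnW.
  rewrite !up// opprB addrC addrA subrK -mulrBl exprMn exprVn sqm.
  rewrite -sqrrN opprB; rewrite ler_pM2r ?invr_gt0//; exact: sqrtr_succB_sqr.
apply: le_trans (H _ _ (leq_subr _ _)); last by rewrite subn_gt0.
rewrite -{1}[zs]add0n big_addn big_mkord; apply: ler_sum => i _.
rewrite /profile_diff /profile ltnNge leq_addl/= ltnNge (leq_trans (leq_addl i zs))//=.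
rewrite addnK -addSn addnK !up ?subn_gt0//.
rewrite opprB addrC addrA subrK -mulrBl exprMn exprVn sqm.
rewrite ler_pM2r ?invr_gt0//; exact: sqrtr_succB_sqr.
Qed.

End Profile.

(** * Blocks of geometrically growing length *)

Section LogBlocks.
Context {R : realType}.
Variables (lam : R) (M n zs : nat).
Hypotheses (lam1 : 1 <= lam) (zsn : (zs < n)%N).
Hypothesis nM : 2 * lam * ln n%:R < M.+1%:R.

(** Positive distances of equal level differ by a factor less than [expR (1 / (2 * lam))]. *)
Let level (a : nat) : nat := Num.truncn (2 * lam * ln a%:R).

Let lam0 : 0 < 2 * lam. Proof. by rewrite mulr_gt0 ?(lt_le_trans _ lam1). Qed.

Let level_ge0 a : (0 < a)%N -> 0 <= 2 * lam * ln a%:R.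
Proof. by move=> a0; rewrite mulr_ge0 ?ln_ge0 ?ler1n// ltW. Qed.

Let le_level a b : (0 < a <= b)%N -> (level a <= level b)%N.
Proof.
move=> /andP[a0 ab]; apply: le_truncn; rewrite ler_pM2l// ler_ln ?ler_nat// posrE ltr0n//.
exact: leq_trans ab.
Qed.

(** From [1 - b / a <= ln (a / b)], which is at most [1 / (2 * lam)] within a level. *)
Let level_gap a b : (0 < b <= a)%N -> level a = level b ->
  2 * lam * (a%:R - b%:R) <= a%:R.
Proof.
move=> /andP[b0 ba] lab; have a0 : (0 < a)%N by exact: leq_trans ba.
have aR : 0 < a%:R :> R by rewrite ltr0n.
have bR : 0 < b%:R :> R by rewrite ltr0n.
have h : 2 * lam * ln a%:R - 2 * lam * ln b%:R <= 1.
  have /andP[_ ua] := truncn_itv (level_ge0 a0).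
  have /andP[lb _] := truncn_itv (level_ge0 b0).
  move: ua lb; rewrite -/(level a) -/(level b) lab -natr1.
  by set x := 2 * lam * _; set y := 2 * lam * _; lra.
have := @le_ln1Dx R (b%:R / a%:R - 1).
rewrite subrKC ltrBrDl subrr divr_gt0// ln_div ?posrE// => /(_ isT) g.
have g' : 2 * lam * (1 - b%:R / a%:R) <= 1.
  apply: le_trans h; rewrite -mulrBr ler_pM2l//.
  by rewrite -[leLHS]opprB -[leRHS]opprB lerN2.
have -> : a%:R - b%:R = a%:R * (1 - b%:R / a%:R) :> R.
  by field; rewrite gt_eqF.
by rewrite mulrCA ger_pMr.
Qed.

(** The shift by one on the right makes the distance of [zs] to itself positive. *)
Let dist k := (if k < zs then zs - k else (k - zs).+1)%N.

Let dist_gt0 k : (0 < dist k)%N.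
Proof. by rewrite /dist; case: (ltnP k zs); lia. Qed.

Let dist_le k : (k < n)%N -> (dist k <= n)%N.
Proof. by rewrite /dist => kn; case: (ltnP k zs); lia. Qed.

Let level_lt k : (k < n)%N -> (level (dist k) < M.+1)%N.
Proof.
move=> kn; rewrite -(ltr_nat R); apply: le_lt_trans nM.
apply: (@le_trans _ _ (2 * lam * ln (dist k)%:R)).
  by have /andP[] := truncn_itv (level_ge0 (dist_gt0 k)).
rewrite ler_pM2l// ler_ln ?posrE ?ltr0n ?ler_nat ?dist_le//.
exact: leq_ltn_trans zsn.
Qed.

Let label k : bool * 'I_M.+1 := ((k < zs)%N, inord (level (dist k))).

Let label_eq k k' : (k < n)%N -> (k' < n)%N -> label k = label k' ->
  (k < zs)%N = (k' < zs)%N /\ level (dist k) = level (dist k').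
Proof.
move=> kn k'n [-> h]; split=> //.
by have := congr1 val h; rewrite /= !inordK// level_lt.
Qed.

(** On each side of [zs] the level is monotone in the distance, so the blocks are intervals. *)
Let label_convex i j k : (i <= j <= k)%N -> (k < n)%N -> label i = label k ->
  label j = label i.
Proof.
move=> /andP[ij jk] kn ik; have jn := leq_ltn_trans jk kn.
have [side lev] := label_eq (leq_ltn_trans ij jn) kn ik.
have sidej : (j < zs)%N = (i < zs)%N by lia.
rewrite /label sidej; congr (_, inord _).
have [iz|iz] := ltnP i zs.
  have h : (dist k <= dist j <= dist i)%N.
    by rewrite /dist sidej -side iz; lia.
  apply/eqP; rewrite eqn_leq {2}lev; apply/andP.
  by split; apply: le_level; rewrite dist_gt0/=; lia.
have h : (dist i <= dist j <= dist k)%N.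
  by rewrite /dist sidej -side ltnNge iz/=; lia.
apply/eqP; rewrite eqn_leq {1}lev; apply/andP.
by split; apply: le_level; rewrite dist_gt0/=; lia.
Qed.

(* Blocks grow geometrically with the distance to [zs]; [start z] is the first
   point of the block of [z]. *)
Lemma log_blocks : exists (lab : nat -> bool * 'I_M.+1) (start : nat -> nat),
  forall z, (z < n)%N -> [/\ (start z <= z)%N,
    (z%:R - (start z)%:R) <= `|z%:R - zs%:R| / lam :> R &
    forall i j, (i < n)%N -> (j < n)%N -> lab i = lab j ->
      (start z <= i)%N = (start z <= j)%N].
Proof.
have lamp : 0 < lam by rewrite (lt_le_trans _ lam1).
have ex z : exists k, label k == label z by exists z.
exists label, (fun z => ex_minn (ex z)) => z zn.
case: ex_minnP => p /eqP pz pmin.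
have pzle : (p <= z)%N by apply: pmin.
have pn := leq_ltn_trans pzle zn.
split=> //.
  have [side lev] := label_eq pn zn pz.
  rewrite ler_pdivlMr//; move: side lev; rewrite /dist.
  have [zz|zz] := ltnP z zs => -> lev.
    (* [level_gap] is relative to the larger distance [zs - p]; the factor 2 in [level] and
       [lam >= 1] turn it into a bound relative to [zs - z]. *)
    have ab : (0 < zs - z <= zs - p)%N by lia.
    have := level_gap ab lev; rewrite !natrB; [|lia|lia].
    rewrite ler0_norm; last by rewrite subr_le0 ler_nat ltnW.
    have pzR : 0 <= z%:R - p%:R :> R by rewrite subr_ge0 ler_nat.
    have : 0 <= (lam - 1) * (z%:R - p%:R) by rewrite mulr_ge0// subr_ge0.
    by lra.
  (* On the right the distance is shifted by one, and the factor 2 absorbs the shift since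
     [z - zs >= 1] once [p < z]. *)
  have [->|pz'] := eqVneq p z; first by rewrite subrr mul0r.
  have ab : (0 < (p - zs).+1 <= (z - zs).+1)%N by lia.
  have zs_p : (zs <= p)%N.
    by have [] := label_eq pn zn pz; lia.
  have := level_gap ab (esym lev); rewrite -!natr1 !natrB//.
  rewrite ger0_norm; last by rewrite subr_ge0 ler_nat.
  have : zs%:R + 1 <= z%:R :> R by rewrite natr1 ler_nat; lia.
  by nra.
move=> i j i_n j_n ij.
(* A block with points on both sides of [p] would contain [p] by convexity, hence be the block of
   [z] and have a point below its first one. *)
suff H k l : (k < n)%N -> (l < n)%N -> label k = label l -> (p <= k)%N -> (p <= l)%N.
  by apply/idP/idP; apply: H.
move=> kn ln kl pk; rewrite leqNgt; apply/negP => lp.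
have lpk : (l <= p <= k)%N by rewrite (ltnW lp) pk.
have := pmin l; rewrite -pz (label_convex lpk kn (esym kl)) eqxx => /(_ isT).
by rewrite leqNgt lp.
Qed.

End LogBlocks.

(** * The dual certificate on the grid *)

Lemma prodrB_le_sum (R : realType) (I : finType) (a b : I -> R) :
  (forall i, 0 <= b i <= a i) -> (forall i, a i <= 1) ->
  \prod_i a i - \prod_i b i <= \sum_i (a i - b i).
Proof.
move=> ba a1.
(* The induction carries the bounds on both products along. *)
suff [] : [/\ \prod_i a i - \prod_i b i <= \sum_i (a i - b i),
    0 <= \prod_i b i, \prod_i b i <= \prod_i a i & \prod_i a i <= 1] by [].
elim/big_rec3: _ => [|i s pb pa _ [h pb0 pba pa1]].
  by rewrite subrr lexx ler01.
have /andP[b0 bai] := ba i; have ai1 := a1 i.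
have a0 : 0 <= a i by rewrite (le_trans b0).
have pa0 : 0 <= pa by rewrite (le_trans pb0).
split.
- have -> : a i * pa - b i * pb = (a i - b i) * pa + b i * (pa - pb) by ring.
  apply: lerD; first by rewrite ler_piMr// subr_ge0.
  by apply: le_trans h; rewrite ler_piMl ?subr_ge0// (le_trans bai).
- by rewrite mulr_ge0.
- by rewrite ler_pM.
- by rewrite mulr_ile1.
Qed.

(** * Orthant indicators *)

Section Orthants.
Context {R : realType} {I : finType} {ns : I -> nat}.
Implicit Types z i : grid ns.

(* The columns of the design in the coordinates given by [mixed_diff]. *)
Definition orthant z i : R := \prod_j (z j <= i j)%N%:R.

Lemma orthantE z i : orthant z i = [forall j, (z j <= i j)%N]%:R.
Proof.
rewrite /orthant; case: (boolP [forall j, _]) => [/forallP h|].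
  by rewrite big1// => j _; rewrite h.
rewrite negb_forall => /existsP[j nj].
by rewrite (bigD1 j)//= (negbTE nj) mul0r.
Qed.

Lemma sum_orthant z : \sum_i orthant z i = \prod_j ((ns j)%:R - (z j)%:R).
Proof.
rewrite (sum_prod_dffun (fun j (k : 'I_(ns j)) => (z j <= k)%N%:R)).
apply: eq_bigr => j _; have zn := ltnW (ltn_ord (z j)).
rewrite -(big_mkord predT (fun k => (z j <= k)%N%:R)).
rewrite (big_cat_nat (leq0n (z j)) zn)/= big1_seq ?add0r; last first.
  by move=> k /=; rewrite mem_index_iota => /andP[_ kz]; rewrite leqNgt kz.
rewrite (eq_big_nat _ _ (F2 := fun => 1)); last first.
  by move=> k /andP[zk _]; rewrite zk.
by rewrite big_const_nat iter_addr_0 natrB.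
Qed.

Lemma card_grid : #|grid ns|%:R = \prod_j (ns j)%:R :> R.
Proof.
transitivity (\sum_(z : grid ns) \prod_(j : I) (1 : R)).
  by rewrite -sum1_card natr_sum; apply: eq_bigr => z _; rewrite big1_eq.
rewrite (sum_prod_dffun (fun j (k : 'I_(ns j)) => 1)).
by apply: eq_bigr => j _; rewrite sumr_const card_ord.
Qed.

(** The orthant of [z] lies in that of [p], so the squared distance counts their difference, which
    is covered by one slab per coordinate. *)
Lemma sum_orthant_sqr_dist z (p : grid ns) : (forall j, (p j <= z j)%N) ->
  \sum_i (orthant z i - orthant p i) ^+ 2 <=
  #|grid ns|%:R * \sum_j ((z j)%:R - (p j)%:R) / (ns j)%:R.
Proof.
move=> pz.
have n0 j : 0 < (ns j)%:R :> R by rewrite ltr0n (leq_ltn_trans _ (ltn_ord (z j))).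
apply: (@le_trans _ _ (\sum_i (orthant p i - orthant z i))); last first.
  rewrite sumrB !sum_orthant card_grid.
  have E (w : grid ns) : \prod_j ((ns j)%:R - (w j)%:R) =
      (\prod_j (ns j)%:R) * \prod_j (1 - (w j)%:R / (ns j)%:R) :> R.
    rewrite -big_split/=; apply: eq_bigr => j _.
    by rewrite mulrBr mulr1 mulrCA divff ?gt_eqF// mulr1.
  rewrite !E -mulrBr ler_wpM2l ?prodr_ge0//.
  apply: (le_trans (prodrB_le_sum _ _)) => [j|j|].
  - rewrite subr_ge0 ler_pdivrMr// mul1r ler_nat ltnW//= lerD2l lerN2.
    by rewrite ler_pM2r ?invr_gt0// ler_nat pz.
  - by rewrite lerBlDr lerDl divr_ge0.
  - by apply: ler_sum => j _; rewrite opprB addrC addrA subrK mulrBl.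
apply: ler_sum => i _; rewrite !orthantE.
case: (boolP [forall j, _]) => [/forallP h|_].
  by have /forallP -> : forall j, (p j <= i j)%N;
    rewrite ?subrr ?expr0n//= => j; rewrite (leq_trans (pz j)).
by rewrite sub0r sqrrN subr0; case: [forall j, _]; rewrite ?expr1n ?expr0n.
Qed.

End Orthants.

Section Certificate.
Context {R : realType} {I : finType} {ns : I -> nat}.
Variables (zs : grid ns) (c lam L : R) (M : nat).
Hypotheses (c0 : 0 < c) (lam1 : 1 <= lam) (ML : 2 * lam * L < M.+1%:R).
Hypothesis zs_low : forall j, c * (ns j)%:R <= (zs j)%:R.
Hypothesis zs_high : forall j, c * (ns j)%:R <= (ns j - zs j)%:R.
Hypothesis nsL : forall j, ln (expR 1 * (ns j)%:R) <= L.
Variable j0 : I.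

Let ns0 j : (0 < ns j)%N. Proof. exact: leq_ltn_trans (ltn_ord (zs j)). Qed.
Let nsR j : 0 < (ns j)%:R :> R. Proof. by rewrite ltr0n. Qed.
Let zs0 j : (0 < zs j)%N.
Proof. by rewrite -(ltr_nat R) (lt_le_trans _ (zs_low j))// mulr_gt0. Qed.
Let zsn j : (zs j < ns j)%N. Proof. exact: ltn_ord. Qed.

Definition certificate (z : grid ns) : R := \prod_j profile (ns j) (zs j) (z j).
Definition certificate_diff (i : grid ns) : R :=
  \prod_j profile_diff (ns j) (zs j) (i j).

Lemma certificate01 z : 0 <= certificate z <= 1.
Proof.
rewrite prodr_ge0/= => [|j _]; last by rewrite profile_ge0// ltnW.
by apply: prodr_ile1 => j _; rewrite profile_ge0 ?profile_le1// ltnW.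
Qed.

Lemma certificate_peak : certificate zs = 1.
Proof. by apply: big1 => j _; exact: profile_peak. Qed.

Lemma certificate_zero (z : grid ns) : (forall j, z j = 0 :> nat) -> certificate z = 0.
Proof. by move=> z0; rewrite /certificate (bigD1 j0)//= z0 profile0 ?mul0r. Qed.

Lemma certificateE z : \sum_i certificate_diff i * orthant z i = certificate z.
Proof.
under eq_bigr do rewrite -big_split/=.
rewrite (sum_prod_dffun (fun j (k : 'I_(ns j)) =>
  profile_diff (ns j) (zs j) k * (z j <= k)%N%:R)).
by apply: eq_bigr => j _; rewrite sum_profile_diff// ltnW.
Qed.

(** The sum factors. By [zs_low] and [zs_high] both sides of the peak have length at least
    [c * ns j], so a coordinate contributes at most [2 * L / (c * ns j)]. *)
Lemma certificate_diff_sqr :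
  \sum_i certificate_diff i ^+ 2 <= (2 / c * L) ^+ #|I| / #|grid ns|%:R.
Proof.
under eq_bigr do rewrite -prodrXl.
rewrite (sum_prod_dffun (fun j (k : 'I_(ns j)) => profile_diff (ns j) (zs j) k ^+ 2)).
rewrite card_grid -prodfV -prodr_const -big_split/=; apply: ler_prod => j _.
rewrite sumr_ge0/= => [|k _]; last exact: sqr_ge0.
apply: (le_trans (sum_profile_diff_sqr (zs0 j) (zsn j))).
have cn : 0 < c * (ns j)%:R by rewrite mulr_gt0.
have h (m : nat) : c * (ns j)%:R <= m%:R -> m%:R^-1 <= (c * (ns j)%:R)^-1 :> R.
  by move=> cm; rewrite lef_pV2 ?posrE// (lt_le_trans cn).
have l0 : 0 <= ln (expR 1 * (ns j)%:R) :> R.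
  by rewrite ln_ge0// -[leLHS]mulr1 ler_pM ?expR_ge1Dx// ?ler1n//
    (le_trans _ (expR_ge1Dx 1))// lerDl.
apply: (@le_trans _ _ (2 * (c * (ns j)%:R)^-1 * L)).
  apply: ler_pM => //.
  by rewrite mulr_natl mulr2n lerD// h.
by rewrite invfM le_eqVlt; apply/orP; left; apply/eqP; ring.
Qed.

(** A product of factors in the unit interval is at most each of them, so [1 - certificate z] is at
    least each one-dimensional defect. *)
Lemma sqr_1Bcertificate_ge (z : grid ns) :
  \sum_j `|(z j)%:R - (zs j)%:R| / (ns j)%:R <= #|I|%:R * (1 - certificate z) ^+ 2.
Proof.
rewrite mulr_natl -sumr_const; apply: ler_sum => j _.
apply: (le_trans (sqr_1Bprofile_ge (zs0 j) (zsn j) (ltnW (ltn_ord (z j))))).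
have p01 k : 0 <= (profile (ns k) (zs k) (z k) : R) <= 1.
  by rewrite profile_ge0 ?profile_le1// ltnW.
rewrite ler_sqr ?nnegrE ?subr_ge0 ?profile_le1//; last by have /andP[] := certificate01 z.
rewrite lerD2l lerN2 /certificate (bigD1 j)//= ler_piMr//.
  by have /andP[] := p01 j.
by apply: prodr_ile1.
Qed.

(** With [p] the vector of first points of the blocks of the coordinates of [z], [orthant p] is
    constant on product blocks, so its distance to [orthant z] bounds the residual of the
    projection. *)
Lemma certificate_blocks : exists lab : grid ns -> {ffun I -> bool * 'I_M.+1},
  forall z, \sum_i (orthant z i - block_avg lab (orthant z) (lab i)) ^+ 2 <=
    #|grid ns|%:R * #|I|%:R / lam * (1 - certificate z) ^+ 2.
Proof.
have nM j : 2 * lam * ln (ns j)%:R < M.+1%:R.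
  apply: le_lt_trans ML; rewrite ler_wpM2l ?mulr_ge0 ?(le_trans _ lam1)//.
  apply: le_trans (nsL j); rewrite ler_ln ?posrE ?mulr_gt0 ?expR_gt0//.
  by rewrite ler_peMl// (le_trans _ (expR_ge1Dx 1))// lerDl.
have {}/choice[lab /choice[start hs]] j := log_blocks lam1 (zsn j) (nM j).
exists (fun i : grid ns => [ffun j => lab j (i j)] : {ffun I -> _}) => z.
have sn j : (start j (z j) < ns j)%N.
  by have [le_s _ _] := hs j _ (ltn_ord (z j)); exact: leq_ltn_trans le_s _.
pose p : grid ns := [ffun j => Ordinal (sn j)].
have pE j : p j = start j (z j) :> nat by rewrite ffunE.
have pz j : (p j <= z j)%N by rewrite pE; have [] := hs j _ (ltn_ord (z j)).
apply: (le_trans (block_avg_best (u := orthant p) _ _)).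
  move=> i i' /ffunP ii'; apply: eq_bigr => j _; congr (_ : bool)%:R.
  have [_ _ h] := hs j _ (ltn_ord (z j)).
  by rewrite pE; apply: h => //; have := ii' j; rewrite !ffunE.
apply: (le_trans (sum_orthant_sqr_dist pz)).
rewrite -!mulrA ler_wpM2l//.
apply: (@le_trans _ _ (lam^-1 * \sum_j `|(z j)%:R - (zs j)%:R| / (ns j)%:R)).
  rewrite mulr_sumr; apply: ler_sum => j _.
  have [_ h _] := hs j _ (ltn_ord (z j)).
  by rewrite mulrA ler_pM2r ?invr_gt0// mulrC pE.
rewrite [leRHS]mulrCA ler_wpM2l ?invr_ge0 ?(le_trans _ lam1)//.
exact: sqr_1Bcertificate_ge.
Qed.

End Certificate.

(** * The risk bound *)

Section NoiseBound.
Context {R : realType} {dT : measure_display} {T : measurableType dT}.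
Context {P : probability T R} {K : finType} {xi : K -> {RV P >-> R}} {s : R}.
Hypotheses (s0 : 0 < s) (iid_xi : iid_normal xi s).
Context {I : finType} {ns : I -> nat}.
Variables (phi : grid ns -> K) (zs z0 : grid ns) (c L : R) (j0 : I).
Hypotheses (phi_bij : bijective phi) (c0 : 0 < c) (L1 : 1 <= L).
Hypothesis zs_low : forall j, c * (ns j)%:R <= (zs j)%:R.
Hypothesis zs_high : forall j, c * (ns j)%:R <= (ns j - zs j)%:R.
Hypothesis nsL : forall j, ln (expR 1 * (ns j)%:R) <= L.
Hypothesis cardL : #|grid ns|%:R <= expR L.
Hypothesis z00 : forall j, z0 j = 0 :> nat.

Let lam : R := Num.sqrt L.
Let d := #|I|.

Let L0 : 0 < L. Proof. exact: lt_le_trans L1. Qed.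
Let lam1 : 1 <= lam. Proof. by rewrite -sqrtr1 ler_wsqrtr. Qed.
Let lamp : 0 < lam. Proof. exact: lt_le_trans lam1. Qed.
Let lam2 : lam ^+ 2 = L. Proof. by rewrite sqr_sqrtr// ltW. Qed.
Let d0 : (0 < d)%N. Proof. by apply/card_gt0P; exists j0. Qed.
Let N0 : 0 < #|grid ns|%:R :> R. Proof. by rewrite ltr0n; apply/card_gt0P; exists z0. Qed.

(** One measurable variable dominates the noise term over the whole cone, so it applies at the
    difference between estimator and competitor, however that depends on [w]. The first constant
    counts blocks, at most [(6 * (lam * L)) ^ d]; the second comes from the residuals. *)
Lemma cone_noise_majorant : exists Y : T -> R,
  [/\ measurable_fun setT Y, forall w, 0 <= Y w,
    (\int[P]_w (Y w)%:E <=
       ((84 * 6 ^+ d + 84 * d%:R * (2 / c) ^+ d) * s ^+ 2 * (lam * L) ^+ d)%:E)%E &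
    forall w (b h : grid ns -> R) (sg : R),
      (forall i, h i = \sum_z b z * orthant z i) -> `|sg| = 1 ->
      sg * b zs + \sum_(z | (z != z0) && (z != zs)) `|b z| <= 0 ->
      2 * (\sum_i xi (phi i) w * h i) - 2^-1 * \sum_i h i ^+ 2 <= Y w].
Proof.
pose M := Num.truncn (2 * lam * L).
have ML : 2 * lam * L < M.+1%:R by exact: truncnS_gt.
have lamL1 : 1 <= lam * L by rewrite -[leLHS]mulr1 ler_pM.
have M3 : M.+1%:R <= 3 * (lam * L).
  rewrite -natr1 (_ : 3 * (lam * L) = 2 * lam * L + lam * L); last by ring.
  by rewrite lerD// truncn_le !mulr_ge0 ?(ltW lamp) ?(ltW L0).
pose q := certificate zs : grid ns -> R.
have q01 z : 0 <= q z <= 1 by exact: (certificate01 c0 zs_low).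
have [lab labP] := certificate_blocks c0 lam1 ML zs_low nsL.
pose r (z i : grid ns) : R := orthant z i - block_avg lab (orthant z) (lab i).
pose k2 := #|grid ns|%:R * d%:R / lam.
pose kap := Num.sqrt k2.
have k20 : 0 < k2 by rewrite divr_gt0// mulr_gt0// ltr0n.
have kap0 : 0 < kap by rewrite sqrtr_gt0.
have kap2 : kap ^+ 2 = k2 by rewrite sqr_sqrtr// ltW.
(* Residuals scaled to norm at most 1. Where [1 - q z = 0] the quotient is 0 by convention, and
   [labP] makes the residual itself zero. *)
pose r1 (z i : grid ns) : R := r z i / (kap * (1 - q z)).
have r1_le (z : grid ns) : \sum_i r1 z i ^+ 2 <= 1.
  under eq_bigr do rewrite expr_div_n.
  rewrite -mulr_suml; have [->|qz] := eqVneq (1 - q z) 0.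
    by rewrite mulr0 expr0n/= invr0 mulr0 ler01.
  rewrite ler_pdivrMr ?mul1r; first by rewrite exprMn kap2; exact: labP.
  by rewrite lt_def sqr_ge0 andbT sqrf_eq0 mulf_neq0// gt_eqF.
have rE (z : grid ns) w : \sum_i xi (phi i) w * r z i =
    kap * (1 - q z) * \sum_i r1 z i * xi (phi i) w.
  have [qz|qz] := eqVneq (1 - q z) 0.
    rewrite qz mulr0 mul0r big1// => i _.
    have : \sum_i r z i ^+ 2 <= 0.
      by apply: le_trans (labP z) _; rewrite -/(q z) qz expr0n/= mulr0.
    rewrite le_eqVlt ltNge sumr_ge0/= ?orbF => [|i' _]; last exact: sqr_ge0.
    rewrite psumr_eq0 => [|i' _]; last exact: sqr_ge0.
    by move=> /allP/(_ i); rewrite mem_index_enum sqrf_eq0 => /(_ isT)/eqP ->; rewrite mulr0.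
  rewrite mulr_sumr; apply: eq_bigr => i _; rewrite /r1 mulrA mulrCA.
  by rewrite divff ?mulr1 1?mulrC// mulf_neq0// gt_eqF.
have [psi' phiK psiK] := phi_bij.
have reidx : forall (v : grid ns -> R) w,
    \sum_k v (psi' k) * xi k w = \sum_i v i * xi (phi i) w.
  move=> v w.
  rewrite (reindex phi)/=; last exact: onW_bij.
  by apply: eq_bigr => i _; rewrite phiK.
have reidx2 : forall v : grid ns -> R, \sum_k v (psi' k) ^+ 2 = \sum_i v i ^+ 2.
  move=> v.
  rewrite (reindex phi)/=; last exact: onW_bij.
  by apply: eq_bigr => i _; rewrite phiK.
have r1K (z : grid ns) : \sum_k r1 z (psi' k) ^+ 2 <= 1 by rewrite reidx2.
have [Y0 [mY0 Y00 Y0P Y0int]] := gaussian_forms_max s0 iid_xi r1K L1 cardL.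
pose D := \sum_i certificate_diff zs i ^+ 2 : R.
(* The squared norm of the projected noise. *)
pose blk w := \sum_B block_sum lab (fun i => xi (phi i) w) B ^+ 2 / block_size lab B : R.
have blk0 w : 0 <= blk w by apply: sumr_ge0 => B _; rewrite divr_ge0 ?sqr_ge0.
have D0 : 0 <= D by apply: sumr_ge0 => i _; exact: sqr_ge0.
have mblkB B : measurable_fun setT (fun w =>
    block_sum lab (fun i => xi (phi i) w) B ^+ 2 / block_size lab B : R).
  apply: measurable_funM => //; apply: measurable_funX.
  rewrite /block_sum; under eq_fun do rewrite big_mkcond.
  by apply: measurable_sum => i; case: (lab i == B).
have mblk : measurable_fun setT blk by exact: measurable_sum.
have blkint : (\int[P]_w (blk w)%:E <= (21 * s ^+ 2 * (6 * (lam * L)) ^+ d)%:E)%E.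
  under eq_integral do rewrite -sumEFin.
  rewrite ge0_integral_sum//; first last.
  - by move=> B w _; rewrite lee_fin divr_ge0 ?sqr_ge0.
  - by move=> B; exact/measurable_EFinP.
  apply: (@le_trans _ _ (\sum_(B : {ffun I -> bool * 'I_M.+1}) (21 * s ^+ 2)%:E)%E).
    apply: lee_sum => B _.
    (* The normalised indicator of the block; its squared norm is 1, or 0 for an empty block. *)
    pose u i : R := (lab i == B)%:R / Num.sqrt (block_size lab B).
    have -> : (\int[P]_w (block_sum lab (fun i => xi (phi i) w) B ^+ 2
        / block_size lab B)%:E = \int[P]_w ((\sum_k u (psi' k) * xi k w) ^+ 2)%:E)%E.
      apply: eq_integral => w _; rewrite reidx; congr EFin.
      under [in RHS]eq_bigr do rewrite mulrAC.
      rewrite -mulr_suml expr_div_n sqr_sqrtr//; congr (_ ^+ 2 / _).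
      rewrite /block_sum big_mkcond; apply: eq_bigr => i _.
      by case: ifP => _; rewrite ?mul1r ?mul0r.
    apply: (gaussian_form_sq s0 iid_xi (r := fun k => u (psi' k))).
    rewrite reidx2; under eq_bigr do rewrite expr_div_n sqr_sqrtr//.
    rewrite -mulr_suml (_ : \sum_i _ = block_size lab B).
      by have [->|nB] := eqVneq (block_size lab B : R) 0; rewrite ?mul0r ?ler01 ?divff.
    rewrite /block_size -sum1_card natr_sum [RHS]big_mkcond/=.
    by apply: eq_bigr => i _; rewrite inE; case: ifP => _; rewrite ?expr1n ?expr0n.
  rewrite sumEFin lee_fin sumr_const card_ffun card_prod card_bool card_ord.
  rewrite -[leLHS]mulr_natr ler_wpM2l ?(mulr_ge0 _ (sqr_ge0 s))// natrX natrM.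
  rewrite lerXn2r ?nnegrE ?mulr_ge0 ?(ltW lamp) ?(ltW L0)//.
  by rewrite (_ : 6 * _ = 2 * (3 * (lam * L))) ?ler_pM2l//; ring.
(* The left side is at most a constant times [lam * L ^ d], and [lam <= lam ^ d] as [d >= 1]: this
   is [d + 1 / 2 <= 3 * d / 2] in the exponent of [L]. *)
have Dle : k2 * D * L <= d%:R * (2 / c) ^+ d * (lam * L) ^+ d.
  have := certificate_diff_sqr c0 zs_low zs_high nsL; rewrite -/D -/d => HD.
  apply: (@le_trans _ _ (k2 * ((2 / c * L) ^+ d / #|grid ns|%:R) * L)).
    by rewrite ler_wpM2r ?(ltW L0)// ler_wpM2l// ltW.
  have -> : k2 * ((2 / c * L) ^+ d / #|grid ns|%:R) * L =
      d%:R * (2 / c) ^+ d * (lam * L ^+ d).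
    rewrite /k2 exprMn -{2}lam2; field.
    by rewrite !gt_eqF.
  rewrite [X in _ <= _ * X]exprMn ler_wpM2l ?mulr_ge0 ?exprn_ge0 ?divr_ge0 ?(ltW c0)//.
  rewrite ler_wpM2r ?exprn_ge0 ?(ltW L0)//.
  by rewrite -[leLHS]expr1 ler_weXn2l.
have kD : 0 <= 4 * (k2 * D) by rewrite mulr_ge0// mulr_ge0// ltW.
exists (fun w => 4 * blk w + 4 * (k2 * D) * Y0 w); split.
- by apply: measurable_funD; apply: measurable_funM.
- by move=> w; apply: addr_ge0; apply: mulr_ge0.
- under eq_integral do rewrite EFinD (EFinM 4) (EFinM (4 * _)).
  rewrite ge0_integralD//; first last.
  + by apply: measurable_funeM; exact/measurable_EFinP.
  + by move=> w _; rewrite mule_ge0 ?lee_fin.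
  + by apply: measurable_funeM; exact/measurable_EFinP.
  + by move=> w _; rewrite mule_ge0 ?lee_fin.
  rewrite !ge0_integralZl_EFin//; first last.
  + exact/measurable_EFinP.
  + by move=> w _; rewrite lee_fin.
  + exact/measurable_EFinP.
  + by move=> w _; rewrite lee_fin.
  apply: (@le_trans _ _ (4%:E * (21 * s ^+ 2 * (6 * (lam * L)) ^+ d)%:E +
      (4 * (k2 * D))%:E * (21 * s ^+ 2 * L)%:E)%E).
    by apply: leeD; apply: lee_wpmul2l => //; rewrite lee_fin.
  rewrite -!EFinM -EFinD lee_fin exprMn.
  have := ler_wpM2l (mulr_ge0 (ler0n R 84) (sqr_ge0 s)) Dle.
  set A := 6 ^+ d; set F := (lam * L) ^+ d; set G := (2 / c) ^+ d.
  by nra.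
- move=> w b h sg hE sg1 cone.
  have z0s : z0 != zs.
    apply/eqP => e; have := zs_low j0; rewrite -e z00 lt_geF// mulr_gt0// ltr0n.
    exact: leq_ltn_trans (ltn_ord (zs j0)).
  have m0 : 0 <= kap * Num.sqrt (Y0 w) by rewrite mulr_ge0 ?sqrtr_ge0// ltW.
  have psiX (z : grid ns) : \sum_i certificate_diff zs i * orthant z i = q z.
    exact: certificateE.
  have qz0 : q z0 = 0 by exact: (certificate_zero c0 zs_low j0).
  have qzs : q zs = 1 by exact: certificate_peak.
  (* [orthant z0] is the constant 1, equal to its block averages. *)
  have rz0 : \sum_i xi (phi i) w * (orthant z0 i - block_avg lab (orthant z0) (lab i)) = 0.
    have one i : orthant z0 i = 1 :> R by rewrite /orthant big1// => j _; rewrite z00.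
    apply: big1 => i _; rewrite /block_avg /block_sum.
    under eq_bigr do rewrite one.
    rewrite sumr_const one -/(block_size lab (lab i)).
    rewrite divff ?gt_eqF ?(block_size_gt0 lab i)//.
    by rewrite subrr mulr0.
  have rle (z : grid ns) : `|\sum_i xi (phi i) w * (orthant z i - block_avg lab (orthant z) (lab i))|
      <= kap * Num.sqrt (Y0 w) * (1 - q z).
    have q1 : 0 <= 1 - q z by rewrite subr_ge0; have /andP[] := q01 z.
    rewrite -/(r z) rE normrM ger0_norm; last by rewrite mulr_ge0// ltW.
    rewrite mulrAC ler_wpM2r// ler_wpM2l ?(ltW kap0)//.
    rewrite -sqrtr_sqr ler_wsqrtr// -reidx; exact: Y0P.
  have := cone_noise_bound hE cone sg1 m0 z0s psiX q01 qz0 qzs rz0 rle.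
  rewrite exprMn kap2 sqr_sqrtr// => /le_trans; apply.
  by rewrite -/(blk w) -/D le_eqVlt; apply/orP; left; apply/eqP; ring.
Qed.

End NoiseBound.

Lemma sqrtM_powR (R : realType) (L : R) (d : nat) : 1 <= L ->
  (Num.sqrt L * L) ^+ d = L `^ (3 * d%:R / 2).
Proof.
move=> L1; have L0 : 0 <= L by rewrite (le_trans _ L1).
have -> : Num.sqrt L * L = L `^ (3 / 2).
  rewrite -{2}(powRr1 L0) -powR12_sqrt// -powRD; first by congr (_ `^ _); field.
  by apply/implyP => _; rewrite gt_eqF// (lt_le_trans _ L1).
by rewrite -powR_mulrn ?powR_ge0// -powRrM; congr (_ `^ _); field.
Qed.

Lemma ln_expR1M_ge1 (R : realType) (y : R) : 1 <= y -> 1 <= ln (expR 1 * y).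
Proof.
move=> y1; have y0 : 0 < y by rewrite (lt_le_trans _ y1).
by rewrite lnM ?posrE ?expR_gt0// expRK lerDl ln_ge0.
Qed.

(** * Counting lattice points *)

Section GridCounting.
Context {R : realType} {I : finType} {ns : I -> nat}.
Hypothesis ns1 : forall j, (1 <= ns j)%N.

Lemma grid_point_inj : injective (@grid_point R I ns).
Proof.
move=> y z /ffunP yz; apply/ffunP => j; apply/val_inj/eqP => /=.
have := yz j; rewrite !ffunE => /mulIf; rewrite invr_eq0 pnatr_eq0 -lt0n => /(_ (ns1 j)).
by move/eqP; rewrite eqr_nat.
Qed.

(** Multiplied out by [ns j] to stay in the natural numbers. *)
Lemma card_grid_slice (j : I) (Q : pred nat) :
  (ns j * #|[pred z : grid ns | Q (z j)]| =
   #|grid ns| * \sum_(k < ns j) (Q k : nat))%N.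
Proof.
apply/eqP; rewrite -(eqr_nat R) !natrM card_grid -sum1_card natr_sum.
have -> : \sum_(z in [pred z : grid ns | Q (z j)]) 1%:R =
    \sum_(z : grid ns) \prod_i ((i == j) ==> Q (z i))%:R :> R.
  rewrite big_mkcond; apply: eq_bigr => z _; rewrite inE (bigD1 j)//= eqxx /=.
  rewrite big1 ?mulr1 => [|i /negbTE -> //]; by case: (Q (z j)).
rewrite (sum_prod_dffun (fun i (k : 'I_(ns i)) => ((i == j) ==> Q k)%:R : R)).
rewrite [in X in _ * X == _](bigD1 j)//= [in X in _ == X * _](bigD1 j)//= eqxx natr_sum.
rewrite (eq_bigr (fun i => (ns i)%:R)); last first.
  move=> i /negbTE ij; rewrite ij/=.
  by rewrite sumr_const card_ord.
apply/eqP; ring.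
Qed.

Lemma slice_lower (c : R) (m : nat) (j : I) (Q : pred nat) :
  c * #|grid ns|%:R <= m%:R -> (m <= #|[pred z : grid ns | Q (z j)]|)%N ->
  c * (ns j)%:R <= (\sum_(k < ns j) (Q k : nat))%N%:R.
Proof.
move=> cm mQ; have N0 : 0 < #|grid ns|%:R :> R.
  by rewrite card_grid prodr_gt0// => i _; rewrite ltr0n.
rewrite -(ler_pM2l N0) -natrM -card_grid_slice natrM mulrCA mulrA -mulrA.
rewrite [leLHS](_ : _ = (ns j)%:R * (c * #|grid ns|%:R)); last by ring.
by rewrite ler_wpM2l// (le_trans cm)// ler_nat.
Qed.

End GridCounting.

Section LatticeCounting.
Context {R : realType} {d : nat}.
Variable ns : 'I_d -> nat.
Local Notation point := {ffun 'I_d -> R}.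

Lemma lattice_designE : lattice_design ns = range (@grid_point R 'I_d ns).
Proof.
apply/seteqP; split=> [u [i iP]|_ [z _ <-]].
  exists [ffun j => Ordinal (iP j).1] => //; apply/ffunP => j.
  by have [_ ->] := iP j; rewrite !ffunE.
by exists (fun j => z j : nat) => j; rewrite ffunE ltn_ord.
Qed.

Lemma card_lattice_le (A : set point) (Q : pred (grid ns)) :
  (forall z, A (grid_point z) -> Q z) ->
  (#|` fset_set (lattice_design ns `&` A)| <= #|Q|)%N.
Proof.
move=> AQ; have fin : finite_set (lattice_design ns `&` A).
  apply: (@sub_finite_set _ _ (range (@grid_point R 'I_d ns))).
    by rewrite lattice_designE; exact: subIsetl.
  exact: finite_image.
apply: (@leq_trans #|` [fset grid_point z | z in Q]%fset|).
  apply: fsubset_leq_card; apply/fsubsetP => u.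
  rewrite in_fset_set// => /set_mem; rewrite lattice_designE => -[[z _ <-] Az].
  by apply/imfsetP; exists z => //; exact: AQ.
by rewrite (leq_trans (leq_imfset_card _ _ _))// cardE.
Qed.

End LatticeCounting.

Section LatticeVertex.
Context {R : realType} {d : nat}.
Variables (ns : 'I_d -> nat) (c : R) (xs : {ffun 'I_d -> R}).
Hypotheses (ns1 : forall j, (1 <= ns j)%N) (c0 : 0 < c).
Hypothesis xs_cube : unit_cube xs.
Hypothesis xs_count : c * (\prod_(j < d) ns j)%N%:R <=
  (minn #|` fset_set (lattice_design ns `&` closed_box xs ones)|
        #|` fset_set (lattice_design ns `&` halfopen_box zeros xs)|)%:R.

(** [zs] rounds [xs] up to the lattice. For each [j] the two boxes lie in the slices of the grid on
    either side of [zs j] in coordinate [j], so their counts bound [ns j - zs j] and [zs j] from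
    below. *)
Lemma lattice_vertex : exists zs : grid ns,
  [/\ forall j, c * (ns j)%:R <= (zs j)%:R,
      forall j, c * (ns j)%:R <= (ns j - zs j)%:R &
      forall j k, (xs j <= k%:R / (ns j)%:R) = (zs j <= k)%N].
Proof.
have n0 j : 0 < (ns j)%:R :> R by rewrite ltr0n.
have ex j : exists k : nat, xs j <= k%:R / (ns j)%:R.
  exists (ns j); rewrite divff ?gt_eqF//.
  by have /andP[_] := xs_cube j; rewrite !ffunE.
pose m j := ex_minn (ex j).
have mP j k : (xs j <= k%:R / (ns j)%:R) = (m j <= k)%N.
  rewrite /m; case: ex_minnP => p px pmin; apply/idP/idP; first exact: pmin.
  by move=> pk; rewrite (le_trans px)// ler_pM2r ?invr_gt0// ler_nat.
have cN (k : nat) : c * (\prod_(j < d) ns j)%N%:R <= k%:R -> c * #|grid ns|%:R <= k%:R.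
  by rewrite card_grid natr_prod.
have up j : c * (ns j)%:R <= (\sum_(k < ns j) (m j <= k : nat))%N%:R.
  apply: (slice_lower ns1 (Q := fun k => (m j <= k)%N) (cN _ xs_count)).
  apply: leq_trans (geq_minl _ _) _; apply: card_lattice_le => z zA.
  by rewrite inE -mP; have := zA j; rewrite !ffunE => /andP[].
have lo j : c * (ns j)%:R <= (\sum_(k < ns j) (k < m j : nat))%N%:R.
  apply: (slice_lower ns1 (Q := fun k => (k < m j)%N) (cN _ xs_count)).
  apply: leq_trans (geq_minr _ _) _; apply: card_lattice_le => z zA.
  by rewrite inE ltnNge -mP -ltNge; have := zA j; rewrite !ffunE => /andP[].
have mn j : (m j <= ns j)%N.
  by rewrite -mP divff ?gt_eqF//; have /andP[_] := xs_cube j; rewrite !ffunE.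
have loE j : (\sum_(k < ns j) (k < m j : nat))%N = m j.
  rewrite -(big_mkord predT (fun k => (k < m j : nat))) (big_cat_nat (leq0n _) (mn j))/=.
  rewrite (eq_big_nat _ _ (F2 := fun=> 1%N)) => [|k /andP[_ ->//]].
  rewrite sum_nat_const_nat subn0 muln1 big1_seq ?addn0// => k /=.
  by rewrite mem_index_iota => /andP[mk _]; rewrite ltnNge mk.
have upE j : (\sum_(k < ns j) (m j <= k : nat))%N = (ns j - m j)%N.
  apply/eqP; rewrite -(eqn_add2l (m j)) subnKC// -{1}(loE j) -big_split/=.
  rewrite (eq_bigr (fun=> 1%N)) => [|k _]; last by case: ltnP.
  by rewrite sum_nat_const card_ord muln1.
(* A priori [xs j] could exceed all lattice coordinates; the count above [xs] excludes this. *)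
have zn j : (m j < ns j)%N.
  rewrite -subn_gt0 -upE -(ltr_nat R) (lt_le_trans _ (up j))//.
  by rewrite mulr_gt0.
exists [ffun j => Ordinal (zn j)]; split=> j; rewrite ffunE/=.
- by rewrite -[X in _ <= X%:R]loE.
- by rewrite -upE.
- exact: mP.
Qed.

End LatticeVertex.

(** [V <= |a1|] makes the constraint active at the competitor, which forces the error into the cone;
    the hypothesis on [Y] then handles the noise. *)
Lemma least_squares_noise_bound (R : realType) (d n : nat) (ns : 'I_d -> nat)
    (x : 'I_n -> {ffun 'I_d -> R}) (phi : grid ns -> 'I_n) (xi : 'I_n -> R)
    (V a1 a0 Y : R) (fstar f fhat : {ffun 'I_d -> R} -> R) (zs z0 : grid ns) :
  (forall j, (1 <= ns j)%N) -> (0 < n)%N ->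
  bijective phi -> (forall z, x (phi z) = grid_point z) ->
  (forall j, z0 j = 0 :> nat) -> z0 != zs ->
  hk0_least_squares x (fun i => fstar (x i) + xi i) V fhat ->
  (hk0_variation f <= V%:E)%E -> V <= `|a1| ->
  (forall i, f (grid_point i) = a1 * orthant zs i + a0) ->
  (forall (b h : grid ns -> R) (sg : R),
      (forall i, h i = \sum_z b z * orthant z i) -> `|sg| = 1 ->
      sg * b zs + \sum_(z | (z != z0) && (z != zs)) `|b z| <= 0 ->
      2 * (\sum_i xi (phi i) * h i) - 2^-1 * \sum_i h i ^+ 2 <= Y) ->
  sq_loss x fhat fstar <= sq_loss x f fstar + n%:R^-1 * Y.
Proof.
move=> ns1 n0 phi_bij xphi z00 z0s [fhatV fhat_min] fV Va1 fE noise.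
have nV0 : 0 < n%:R^-1 :> R by rewrite invr_gt0 ltr0n.
have reidx (F : 'I_n -> R) : \sum_i F i = \sum_(z : grid ns) F (phi z).
  by rewrite (reindex phi)//; exact: onW_bij.
rewrite /sq_loss -mulrDr ler_pM2l// !reidx.
under eq_bigr do rewrite xphi.
under [X in _ <= X + _]eq_bigr do rewrite xphi.
have := fhat_min _ (hk0_variation_midpoint fhatV fV).
rewrite ler_pM2l// !reidx => hmin.
pose th (z : grid ns) := fhat (grid_point z).
pose t (z : grid ns) := f (grid_point z).
have := @midpoint_basic_inequality R _ t th (fun z : grid ns => fstar (grid_point z))
  (fun z => xi (phi z)).
have -> : (\sum_i (fstar (grid_point i) + xi (phi i) - th i) ^+ 2 <=
   \sum_i (fstar (grid_point i) + xi (phi i) - 2^-1 * (th i + t i)) ^+ 2) = true.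
  move: hmin; under eq_bigr do rewrite xphi.
  by under [X in _ <= X]eq_bigr do rewrite xphi.
move=> /(_ isT) /le_trans; apply; rewrite lerD2l.
pose b0 := mixed_diff th.
(* The coefficients of the error: those of the estimator, minus [a1] at [zs] and [a0] at the
   constant. *)
pose b (z : grid ns) := b0 z - a1 * (z == zs)%:R - a0 * (z == z0)%:R.
pose sg : R := if 0 <= a1 then 1 else -1.
apply: (noise b (fun z => th z - t z) sg).
- move=> i; rewrite /t fE -[in LHS](sum_mixed_diff th i).
  under [in RHS]eq_bigr do rewrite !mulrBl.
  rewrite !sumrB opprD addrA; congr (_ - _ - _).
    rewrite (bigD1 zs)//= eqxx mulr1 big1 ?addr0// => z /negbTE ->.
    by rewrite mulr0 mul0r.
  rewrite (bigD1 z0)//= eqxx mulr1 big1 ?addr0 => [|z /negbTE ->].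
    by rewrite /orthant big1 ?mulr1// => j _; rewrite z00.
  by rewrite mulr0 mul0r.
- by rewrite /sg; case: ifP => _; rewrite ?normrN normr1.
- rewrite /b eqxx (eq_sym zs) (negbTE z0s) mulr0 subr0 mulr1 mulrBr.
  have -> : sg * a1 = `|a1|.
    rewrite /sg; case: lerP => a10; first by rewrite mul1r ger0_norm.
    by rewrite mulN1r ltr0_norm.
  rewrite (eq_bigr (fun z => `|b0 z|)); last first.
    by move=> z /andP[/negbTE -> /negbTE ->]; rewrite !mulr0 !subr0.
  (* [z0] is the only grid point of empty support. The cone condition follows:
     [sg * b zs <= |b0 zs| - |a1|], and the other coefficients sum to at most [V - |b0 zs|]. *)
  have l1 : \sum_(z | z != z0) `|b0 z| <= V.
    rewrite -lee_fin; apply: le_trans fhatV.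
    rewrite (eq_bigl (fun z => grid_support z != finset.set0)).
      exact: (mixed_diff_le_hk0 ns1 fhat).
    move=> z; congr negb; apply/eqP/eqP => [->|/setP z_eq].
      by apply/setP => j; rewrite !inE z00.
    apply/ffunP => j; apply/val_inj => /=; rewrite z00.
    by have := z_eq j; rewrite !inE => /negbFE/eqP.
  move: l1; rewrite (bigD1 zs) 1?eq_sym//= => l1.
  have : sg * b0 zs <= `|b0 zs|.
    rewrite (le_trans (ler_norm _))// normrM /sg.
    by case: ifP => _; rewrite ?normrN normr1 mul1r.
  by lra.
Qed.

Lemma lattice_enumeration (R : realType) (d n : nat) (ns : 'I_d -> nat)
    (x : 'I_n -> {ffun 'I_d -> R}) :
  (forall j, (1 <= ns j)%N) -> n = (\prod_(j < d) ns j)%N -> injective x ->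
  range x = lattice_design ns ->
  exists2 phi : grid ns -> 'I_n, bijective phi & forall z, x (phi z) = grid_point z.
Proof.
move=> ns1 nE xinj xE.
have /choice[phi phiE] (z : grid ns) : exists k, x k = grid_point z.
  have : lattice_design ns (@grid_point R _ ns z) by rewrite lattice_designE; exists z.
  by rewrite -xE => -[k _ xk]; exists k.
exists phi => //; apply: inj_card_bij => [y z yz|].
  by apply: (@grid_point_inj R _ _ ns1); rewrite -!phiE yz.
by rewrite card_ord nE -(ler_nat R) card_grid natr_prod.
Qed.

Theorem theorem4p7 (R : realType) (d : nat) (c : R) (hd : (1 <= d)%N)
    (hc0 : 0 < c) (hc : c <= 1 / 2) :
  exists C : R,
    forall (ns : 'I_d -> nat) (n : nat) (x : 'I_n -> {ffun 'I_d -> R})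
      (sigma V : R) (fstar : {ffun 'I_d -> R} -> R)
      (dT : measure_display) (T : measurableType dT) (P : probability T R)
      (xi : 'I_n -> {RV P >-> R}) (fhat : T -> {ffun 'I_d -> R} -> R),
    (forall j, (1 <= ns j)%N) ->
    n = (\prod_(j < d) ns j)%N ->
    (1 < n)%N ->
    injective x ->
    range x = lattice_design ns ->
    0 < sigma ->
    0 < V ->
    iid_normal xi sigma ->
    (forall w, hk0_least_squares x (fun i => fstar (x i) + xi i w) V (fhat w)) ->
    (risk P x fhat fstar <=
      ereal_inf
        [set (sq_loss x f fstar +
              C * (sigma ^+ 2 / n%:R) *
              ln (expR 1 * n%:R) `^ (3 * d%:R / 2) *
              ln (expR 1 * ln (expR 1 * n%:R)) `^ ((2 * d%:R - 1) / 2))%:E |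
         f in [set f | rect_indicators ns c f /\ hk0_variation f = V%:E]])%E.
Proof.
pose K : R := 84 * 6 ^+ d + 84 * d%:R * (2 / c) ^+ d.
exists K => ns n x sigma V fstar dT T P xi fhat ns1 nE n1 xinj xE s0 V0 iid_xi fhatP.
apply: le_ereal_inf_tmp => _ [f [[a1 [a0 [xs [xs_cube fE xs_count]]]] fV] <-].
have [zs [zs_low zs_high zsP]] := lattice_vertex ns1 hc0 xs_cube xs_count.
have [phi phi_bij phiE] := lattice_enumeration ns1 nE xinj xE.
have n0 : 0 < n%:R :> R by rewrite ltr0n ltnW.
pose L : R := ln (expR 1 * n%:R).
have L1 : 1 <= L by apply: ln_expR1M_ge1; rewrite ler1n ltnW.
have cardE : #|grid ns|%:R = n%:R :> R by rewrite card_grid nE natr_prod.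
have cardL : #|grid ns|%:R <= expR L.
  rewrite cardE lnK ?posrE ?mulr_gt0 ?expR_gt0// ler_peMl ?ler0n//.
  by rewrite (le_trans _ (expR_ge1Dx 1))// lerDl.
have nsL j : ln (expR 1 * (ns j)%:R) <= L.
  rewrite ler_ln ?posrE ?mulr_gt0 ?expR_gt0 ?ltr0n ?(ltnW n1)//.
  rewrite ler_pM2l ?expR_gt0// ler_nat; apply: dvdn_leq; first exact: ltnW.
  by rewrite nE (bigD1 j)//= dvdn_mulr.
pose j0 : 'I_d := Ordinal hd.
pose z0 : grid ns := [ffun j => Ordinal (ns1 j)].
have z00 j : z0 j = 0 :> nat by rewrite ffunE.
have zs0 j : (0 < zs j)%N.
  by rewrite -(ltr_nat R) (lt_le_trans _ (zs_low j))// mulr_gt0// ltr0n.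
have z0s : z0 != zs by apply/eqP => e; have := zs0 j0; rewrite -e z00.
have [Y [mY Y0 YE Ymaj]] := cone_noise_majorant s0 iid_xi j0 phi_bij hc0 L1
  zs_low zs_high nsL cardL z00.
(* [zs j] is the least index of a lattice coordinate at or above [xs j]; as it is positive, so is
   [xs j]. *)
have xs01 j : 0 < xs j <= 1.
  have /andP[_] := xs_cube j; rewrite !ffunE => -> /=; rewrite andbT ltNge.
  by have := zsP j 0; rewrite mul0r => ->; rewrite -ltnNge.
have Va1 : V <= `|a1|.
  by rewrite -lee_fin -fV; exact: hk0_variation_indicator xs01 fE.
have fgrid (i : grid ns) : f (grid_point i) = a1 * orthant zs i + a0.
  have pt01 j : 0 <= ((i j)%:R / (ns j)%:R : R) <= 1.
    by rewrite divr_ge0//= ler_pdivrMr ?ltr0n// mul1r ler_nat ltnW.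
  rewrite fE; last by move=> j; rewrite !ffunE.
  congr (_ * _ + _); rewrite orthantE indicE; congr (_ : bool)%:R.
  apply/idP/forallP => [/set_mem h j|h].
    by rewrite -zsP; have := h j; rewrite !ffunE => /andP[].
  apply/mem_set => j; rewrite !ffunE zsP h /=.
  by have /andP[] := pt01 j.
have loss_le w : sq_loss x (fhat w) fstar <= sq_loss x f fstar + n%:R^-1 * Y w.
  apply: (least_squares_noise_bound ns1 (ltnW n1) phi_bij phiE z00 z0s (fhatP w) _
    Va1 fgrid (Ymaj w)).
  by rewrite fV.
have loss0 (g : _ -> R) : 0 <= sq_loss x g fstar.
  by rewrite mulr_ge0// sumr_ge0// => i _; rewrite sqr_ge0.
rewrite /risk unlock.
(* The loss is compared under the integral with a measurable majorant, since [fhat] is only given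
   pointwise. *)
apply: (@le_trans _ _ (\int[P]_w (sq_loss x f fstar + n%:R^-1 * Y w)%:E)%E).
  by apply: ge0_le_integral_nonmeas => w; rewrite lee_fin.
under eq_integral do rewrite EFinD (EFinM _ (Y _)).
rewrite ge0_integralD//; first last.
- by apply: measurable_funeM; exact/measurable_EFinP.
- by move=> w _; rewrite mule_ge0 ?lee_fin// invr_ge0.
- by move=> w _; rewrite lee_fin.
rewrite integral_cst//= probability_setT mule1.
rewrite ge0_integralZl_EFin//; first last.
- exact/measurable_EFinP.
- by move=> w _; rewrite lee_fin.
apply: (@le_trans _ _ ((sq_loss x f fstar)%:E + n%:R^-1%:E *
    (K * sigma ^+ 2 * (Num.sqrt L * L) ^+ d)%:E)%E).
  rewrite leeD2l// lee_wpmul2l ?lee_fin ?invr_ge0//.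
  by move: YE; rewrite card_ord.
rewrite -EFinM -EFinD lee_fin lerD2l sqrtM_powR//.
have K0 : 0 <= K.
  by rewrite addr_ge0 ?mulr_ge0 ?exprn_ge0 ?divr_ge0// ltW.
(* The exponent is nonnegative and the iterated logarithm at least 1, so this factor can be
   inserted. *)
have loglog1 : 1 <= ln (expR 1 * L) `^ ((2 * d%:R - 1) / 2).
  apply: (@le_trans _ _ (1 `^ ((2 * d%:R - 1) / 2))); first by rewrite powR1.
  apply: ge0_ler_powR.
  - by rewrite divr_ge0// subr_ge0 -natrM ler1n muln_gt0.
  - by rewrite nnegrE.
  - by rewrite nnegrE (le_trans _ (ln_expR1M_ge1 L1)).
  - exact: ln_expR1M_ge1.
rewrite (_ : n%:R^-1 * _ = K * (sigma ^+ 2 / n%:R) * L `^ (3 * d%:R / 2)); last by ring.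
rewrite ler_peMr//; apply: mulr_ge0; last exact: powR_ge0.
by rewrite mulr_ge0// divr_ge0// sqr_ge0.
Qed.
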